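(* Let $G\in M_{n,m}(\mathbb Z)$, $H\in M_{m,q}(\mathbb Z)$, $K\in M_{n,p}(\mathbb Z)$, $L\in M_{p,q}(\mathbb Z)$ be matrices with non-negative entries, such that $$GH=KL\quad\text{and}\quad G^tK=HL^t .$$ Then the following conditions are equivalent. (a) There exists a (symmetric) commuting square $(A\subset B\subset D,\ A\subset C\subset D,\ \mathrm{tr}_D)$ of multi-matrix algebras, with inclusion matrices $A\subset_G B$, $B\subset_H D$, $A\subset_K C$, $C\subset_L D$. (b) There exists a pair of matrices $(u,v)$ satisfying the bi-unitary condition, i.e. $$u=\bigoplus_{(i,k)}u^{(i,k)},\qquad v=\bigoplus_{(j,l)}v^{(j,l)},$$ where the direct summands $$u^{(i,k)}=\Big(u^{(i,k)}_{(j,\rho,\sigma)(l,\phi,\psi)}\Big),\qquad v^{(j,l)}=\Big(v^{(j,l)}_{(i,\rho,\phi)(k,\sigma,\psi)}\Big)$$ are unitary matrices and $$v^{(j,l)}_{(i,\rho,\phi)(k,\sigma,\psi)}=\sqrt{\frac{\alpha_i\delta_k}{\beta_j\gamma_l}}\;u^{(i,k)}_{(j,\rho,\sigma)(l,\phi,\psi)}.$$ Here $\alpha_i,\beta_j,\gamma_l,\delta_k$ are the trace weights on $A$, $B$, $C$, $D$ respectively coming from a faithful trace $\mathrm{tr}_D$ on $D$; that is, $\delta=(\delta_k)_{k=1}^q$ is a vector with strictly positive entries, and $\beta=H\delta$, $\gamma=L\delta$, $\alpha=G\beta=K\gamma$.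
   Context: A multi-matrix algebra is a finite direct sum of full complex matrix algebras. $A\subset_G B$ means that $A$ is a unital $*$-subalgebra of $B$ with inclusion matrix $G$ (rows labeled by the minimal central projections of $A$, columns by those of $B$; $G_{ij}$ is the multiplicity of the $i$-th summand of $A$ in the $j$-th summand of $B$). The trace weights of a trace are its values on minimal projections of the simple summands. Algebras $A\subset B\subset D$, $A\subset C\subset D$ with a faithful trace $\mathrm{tr}_D$ on $D$ form a commuting square if the $\mathrm{tr}_D$-preserving conditional expectations of $D$ onto $A,B,C$ satisfy $E_A=E_BE_C=E_CE_B$. It is called symmetric if the inclusion matrices satisfy $G^tK=HL^t$ in addition to $GH=KL$. Index conventions: $i,j,l,k$ label the minimal central projections of $A,B,C,D$ respectively. Let $\mathcal S=\{(i,j,k,\rho,\sigma): G_{ij}H_{jk}\ne 0,\ 1\le\rho\le G_{ij},\ 1\le\sigma\le H_{jk}\}$ and $\mathcal T=\{(i,l,k,\phi,\psi): K_{il}L_{lk}\ne0,\ 1\le\phi\le K_{il},\ 1\le\psi\le L_{lk}\}$. The summand $u^{(i,k)}$ is defined for each $(i,k)$ with $(GH)_{ik}=(KL)_{ik}\neq0$; its rows are indexed by the $(j,\rho,\sigma)$ with $(i,j,k,\rho,\sigma)\in\mathcal S$ and its columns by the $(l,\phi,\psi)$ with $(i,l,k,\phi,\psi)\in\mathcal T$. The summand $v^{(j,l)}$ is defined for each $(j,l)$ with $(G^tK)_{jl}=(HL^t)_{jl}\ne0$; its rows are indexed by the $(i,\rho,\phi)$ with $G_{ij}K_{il}\ne0$,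 $1\le\rho\le G_{ij}$, $1\le\phi\le K_{il}$, and its columns by the $(k,\sigma,\psi)$ with $H_{jk}L_{lk}\neq0$, $1\le\sigma\le H_{jk}$, $1\le\psi\le L_{lk}$.
   Formalization: The formal theorem additionally assumes that G, H, K, L have no zero row and no zero column (automatic for inclusion matrices of unital inclusions); without this (b) can hold while (a) fails, e.g. G=(1 0), H=I_2, K=(1), L=(1 0). *)

(* Defs.v *)
From HB Require Import structures.
From mathcomp Require Export all_boot all_order all_algebra.
From mathcomp Require Export spectral sesquilinear complex.
From mathcomp Require Export classical_sets reals.

Set Implicit Arguments.
Unset Strict Implicit.
Unset Printing Implicit Defensive.
Import Order.TTheory GRing.Theory Num.Theory.
Local Open Scope ring_scope.
Local Open Scope sesquilinear_scope.
Local Open Scope complex_scope.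

(* The direct sum of the full matrix algebras 'M_(a i), i < r.  The zero
   summands 'M_0 are excluded where it matters, by [ms_dim_gt0] below. *)
Definition multimatrix (C : pzRingType) (r : nat) (a : 'I_r -> nat) :=
  {dffun forall i : 'I_r, 'M[C]_(a i)}.

Section MultimatrixAlgebra.
Variables (C : pzRingType) (r : nat) (a : 'I_r -> nat).
Local Notation M := (multimatrix C a).

HB.instance Definition _ := Choice.on M.

Definition mm_zero : M := [ffun i => 0 : 'M[C]_(a i)].
Definition mm_opp (x : M) : M := [ffun i => - x i].
Definition mm_add (x y : M) : M := [ffun i => x i + y i].
Definition mm_one : M := [ffun i => 1 : 'M[C]_(a i)].
Definition mm_mul (x y : M) : M := [ffun i => x i *m y i].
Definition mm_scale (c : C) (x : M) : M := [ffun i => c *: x i].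

Fact mm_addA : associative mm_add.
Proof. by move=> x y z; apply/ffunP => i; rewrite !ffunE addrA. Qed.
Fact mm_addC : commutative mm_add.
Proof. by move=> x y; apply/ffunP => i; rewrite !ffunE addrC. Qed.
Fact mm_add0 : left_id mm_zero mm_add.
Proof. by move=> x; apply/ffunP => i; rewrite !ffunE add0r. Qed.
Fact mm_addN : left_inverse mm_zero mm_opp mm_add.
Proof. by move=> x; apply/ffunP => i; rewrite !ffunE addNr. Qed.
HB.instance Definition _ :=
  GRing.isZmodule.Build M mm_addA mm_addC mm_add0 mm_addN.

Fact mm_mulA : associative mm_mul.
Proof. by move=> x y z; apply/ffunP => i; rewrite !ffunE mulmxA. Qed.
Fact mm_mul1l : left_id mm_one mm_mul.
Proof. by move=> x; apply/ffunP => i; rewrite !ffunE mul1mx. Qed.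
Fact mm_mul1r : right_id mm_one mm_mul.
Proof. by move=> x; apply/ffunP => i; rewrite !ffunE mulmx1. Qed.
Fact mm_mulDl : left_distributive mm_mul mm_add.
Proof. by move=> x y z; apply/ffunP => i; rewrite !ffunE mulmxDl. Qed.
Fact mm_mulDr : right_distributive mm_mul mm_add.
Proof. by move=> x y z; apply/ffunP => i; rewrite !ffunE mulmxDr. Qed.
HB.instance Definition _ := GRing.Zmodule_isPzRing.Build M
  mm_mulA mm_mul1l mm_mul1r mm_mulDl mm_mulDr.

Fact mm_scaleA b c (x : M) : mm_scale b (mm_scale c x) = mm_scale (b * c) x.
Proof. by apply/ffunP => i; rewrite !ffunE scalerA. Qed.
Fact mm_scale1 : left_id 1 mm_scale.
Proof. by move=> x; apply/ffunP => i; rewrite !ffunE scale1r. Qed.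
Fact mm_scaleDr : right_distributive mm_scale +%R.
Proof. by move=> c x y; apply/ffunP => i; rewrite !ffunE scalerDr. Qed.
Fact mm_scaleDl (x : M) : {morph mm_scale^~ x : b c / b + c}.
Proof. by move=> b c; apply/ffunP => i; rewrite !ffunE scalerDl. Qed.
HB.instance Definition _ := GRing.Zmodule_isLmodule.Build C M
  mm_scaleA mm_scale1 mm_scaleDr mm_scaleDl.
End MultimatrixAlgebra.

Section CommutingSquares.
Variable F : numClosedFieldType.

Definition mm_star (r : nat) (a : 'I_r -> nat) (x : multimatrix F a) :
    multimatrix F a :=
  [ffun i => (x i)^t*].

Definition mm_psd (r : nat) (a : 'I_r -> nat) (x : multimatrix F a) : Prop :=
  forall (i : 'I_r) (w : 'cV[F]_(a i)), 0 <= (w^t* *m x i *m w) 0 0.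

(* Unitarity of a matrix whose rows and columns are indexed by arbitrary
   finite types. *)
Definition unitary (I J : finType) (u : I -> J -> F) : Prop :=
  (forall i i', \sum_j u i j * (u i' j)^* = (i == i')%:R) /\
  (forall j j', \sum_i (u i j)^* * u i j' = (j == j')%:R).

Record star_embedding (r s : nat) (a : 'I_r -> nat) (d : 'I_s -> nat)
    (f : multimatrix F a -> multimatrix F d) : Prop := StarEmbedding {
  se_linear : linear f;
  se_mul : {morph f : x y / x * y};
  se_one : f 1 = 1;
  se_star : {morph f : x / mm_star x};
  se_inj : injective f
}.

(* A multi-matrix unital *-subalgebra of the multi-matrix algebra with block
   sizes d, with r summands: the range of ms_emb, which identifies it with a
   direct sum of full matrix algebras.  The identification labels its minimal
   central projections by 'I_r. *)
Record mmsub (s : nat) (d : 'I_s -> nat) (r : nat) := MMSub {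
  ms_dim : 'I_r -> nat;
  ms_emb : multimatrix F ms_dim -> multimatrix F d;
  ms_dim_gt0 : forall i, (0 < ms_dim i)%N;
  ms_embP : star_embedding ms_emb
}.
Arguments ms_emb [s d r] A x : rename.

Definition ms_set (s : nat) (d : 'I_s -> nat) (r : nat) (A : mmsub d r) :
    set (multimatrix F d) :=
  range (ms_emb A).

Fact star_embedding_id (s : nat) (d : 'I_s -> nat) :
  star_embedding (@id (multimatrix F d)).
Proof. by split. Qed.

Definition ms_full (s : nat) (d : 'I_s -> nat) (d_gt0 : forall k, (0 < d k)%N) :
    mmsub d s :=
  MMSub d_gt0 (star_embedding_id d).

(* Restricting the representation of B on C^(ms_dim B j), given by its j-th
   summand, to A yields a representation unitarily equivalent to the direct
   sum over i of G i j copies of the representation of A given by its i-th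
   summand.  The columns of W with index (i, rho, _) span the rho-th copy of
   the i-th one. *)
Definition inclusion_matrix (s : nat) (d : 'I_s -> nat) (r t : nat)
    (A : mmsub d r) (B : mmsub d t) (G : 'M[nat]_(r, t)) : Prop :=
  forall j : 'I_t,
  exists W : 'I_(ms_dim B j) -> {i : 'I_r & ('I_(G i j) * 'I_(ms_dim A i))%type}
             -> F,
    unitary W /\
    forall (x : multimatrix F (ms_dim A)) (y : multimatrix F (ms_dim B)),
      ms_emb A x = ms_emb B y ->
    forall (h : 'I_(ms_dim B j)) (i : 'I_r) (rho : 'I_(G i j))
           (e : 'I_(ms_dim A i)),
      \sum_h' y j h h' * W h' (existT _ i (rho, e)) =
      \sum_e' W h (existT _ i (rho, e')) * x i e' e.

Definition ms_incl (s : nat) (d : 'I_s -> nat) (r t : nat)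
    (A : mmsub d r) (G : 'M[nat]_(r, t)) (B : mmsub d t) : Prop :=
  (ms_set A `<=` ms_set B)%classic /\ inclusion_matrix A B G.

Record faithful_trace (s : nat) (d : 'I_s -> nat) (tr : multimatrix F d -> F) :
    Prop := FaithfulTrace {
  ft_linear : scalar tr;
  ft_mulC : forall x y, tr (x * y) = tr (y * x);
  ft_gt0 : forall x, x != 0 -> 0 < tr (mm_star x * x)
}.

Record cond_exp (s : nat) (d : 'I_s -> nat) (tr : multimatrix F d -> F)
    (r : nat) (A : mmsub d r) (E : multimatrix F d -> multimatrix F d) : Prop :=
  CondExp {
  ce_linear : linear E;
  ce_range : forall x, ms_set A (E x);
  ce_id : forall a, ms_set A a -> E a = a;
  ce_bimod : forall a x b, ms_set A a -> ms_set A b ->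
    E (a * x * b) = a * E x * b;
  ce_psd : forall x, mm_psd x -> mm_psd (E x);
  ce_tr : forall x, tr (E x) = tr x
}.

(* The trace-preserving conditional expectation on a given subalgebra exists
   and is unique, so the quantifiers below just name the three of them. *)
Definition commuting_square (s : nat) (d : 'I_s -> nat)
    (tr : multimatrix F d -> F) (n m p : nat)
    (A : mmsub d n) (B : mmsub d m) (C : mmsub d p) : Prop :=
  exists EA EB EC : multimatrix F d -> multimatrix F d,
    [/\ cond_exp tr A EA, cond_exp tr B EB, cond_exp tr C EC,
        EA =1 EB \o EC & EA =1 EC \o EB].

End CommutingSquares.

Section BiUnitary.
Variable R : rcfType.

(* A nonnegative integer matrix without zero rows and zero columns.  The
   inclusion matrix of a unital inclusion always has this property. *)
Definition no_zero_lines (n m : nat) (G : 'M[nat]_(n, m)) : Prop :=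
  (forall i, row i G != 0) /\ (forall j, col j G != 0).

Definition realmx (n m : nat) (G : 'M[nat]_(n, m)) : 'M[R]_(n, m) :=
  map_mx (fun e : nat => e%:R) G.

Definition symmetric_inclusions (n m p q : nat)
    (G : 'M[nat]_(n, m)) (H : 'M[nat]_(m, q))
    (K : 'M[nat]_(n, p)) (L : 'M[nat]_(p, q)) : Prop :=
  G *m H = K *m L /\ G^T *m K = H *m L^T.

Definition trace_weights (n m p q : nat)
    (G : 'M[nat]_(n, m)) (H : 'M[nat]_(m, q))
    (K : 'M[nat]_(n, p)) (L : 'M[nat]_(p, q))
    (alpha : 'cV[R]_n) (beta : 'cV[R]_m)
    (gamma : 'cV[R]_p) (delta : 'cV[R]_q) : Prop :=
  [/\ forall k, 0 < delta k 0,
      beta = realmx H *m delta, gamma = realmx L *m delta,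
      alpha = realmx G *m beta & alpha = realmx K *m gamma].

(* The types of the families of direct summands u i k and v j l.  The ordinal
   types 'I_(G i j) etc. are empty when the multiplicity vanishes, so that only
   the indices with G i j * H j k != 0 etc. contribute, and the summands for
   which (GH) i k = 0 or (G^T K) j l = 0 are empty matrices. *)
Definition u_family (n m p q : nat)
    (G : 'M[nat]_(n, m)) (H : 'M[nat]_(m, q))
    (K : 'M[nat]_(n, p)) (L : 'M[nat]_(p, q)) : Type :=
  forall (i : 'I_n) (k : 'I_q),
    {j : 'I_m & ('I_(G i j) * 'I_(H j k))%type} ->
    {l : 'I_p & ('I_(K i l) * 'I_(L l k))%type} -> R[i].

Definition v_family (n m p q : nat)
    (G : 'M[nat]_(n, m)) (H : 'M[nat]_(m, q))
    (K : 'M[nat]_(n, p)) (L : 'M[nat]_(p, q)) : Type :=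
  forall (j : 'I_m) (l : 'I_p),
    {i : 'I_n & ('I_(G i j) * 'I_(K i l))%type} ->
    {k : 'I_q & ('I_(H j k) * 'I_(L l k))%type} -> R[i].

Definition bi_unitary (n m p q : nat)
    (G : 'M[nat]_(n, m)) (H : 'M[nat]_(m, q))
    (K : 'M[nat]_(n, p)) (L : 'M[nat]_(p, q))
    (alpha : 'cV[R]_n) (beta : 'cV[R]_m)
    (gamma : 'cV[R]_p) (delta : 'cV[R]_q)
    (u : u_family G H K L) (v : v_family G H K L) : Prop :=
  [/\ forall i k, unitary (u i k),
      forall j l, unitary (v j l) &
      forall i j k l (rho : 'I_(G i j)) (sigma : 'I_(H j k))
             (phi : 'I_(K i l)) (psi : 'I_(L l k)),
        v j l (existT _ i (rho, phi)) (existT _ k (sigma, psi)) =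
        (Num.sqrt (alpha i 0 * delta k 0 / (beta j 0 * gamma l 0)))%:C *
        u i k (existT _ j (rho, sigma)) (existT _ l (phi, psi))].

End BiUnitary.

(* Main.v *)
Require Import Defs.
From HB Require Import structures.
From mathcomp Require Import all_boot all_order all_algebra.
From mathcomp Require Import complex reals boolp.
Set Implicit Arguments.
Unset Strict Implicit.
Unset Printing Implicit Defensive.
Import Order.TTheory GRing.Theory Num.Theory.
Local Open Scope ring_scope.
Local Open Scope sesquilinear_scope.

(** An inclusion of multi-matrix algebras with a given inclusion matrix amounts,
   for each summand of the larger algebra, to an orthogonal decomposition of its
   defining representation into copies of those of the smaller one; such a
   decomposition is called a [frame] below, and the inclusion is then block
   diagonal ([frame_of_incl], [incl_of_frame]).  In a square of inclusions, the
   [k]-th representation of [D] is decomposed into irreducible representations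
   of [A] in two ways, through [B] and through [C].  By Schur's lemma the copies
   of the [i]-th representation in the first decomposition overlap in scalars
   with those in the second one, and these scalars form a unitary matrix [u i k]
   ([overlap_exists], [overlap_unitary]).

   The conditional expectations are explicit: they average the compressions to
   the copies of each summand ([cexp]).  The square commutes exactly when the
   expectations onto [A] and onto [B] agree on [C].  For [z] in [C], expanding
   the expectation onto [B] in terms of [u] gives a sum of terms
   [W_x W'_x^* z_l W'_x' W_x'^*], where [x] and [x'] run over the row indices
   [(i, rho, phi)] of [v j l], with coefficients which are, up to positive
   factors, the inner products of the rows [x] and [x'] of [v j l]
   ([cexp_coord_gram], [rows_gram]); the expectation onto [A] is the same sum for
   orthonormal rows.  Hence the square commutes exactly when all the [v j l] have
   orthonormal rows ([cexp_coord_gramP], [commuting_squareP], [rows_gramP]), and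
   as [G^T K = H L^T] makes these matrices square, exactly when they are unitary.

   Conversely, given [u], let [A] be commutative with its inclusions in [B] and
   [C] and that of [B] in [D] in standard position.  Apply [u] to the resulting
   decomposition of the representations of [D] over [A], and regroup the outcome
   into copies of the representations of [C]: this defines an inclusion of [C]
   in [D] which extends that of [A] and whose overlap with [B] is [u]
   ([overlap_constr]), so the same criterion applies. *)

Arguments ms_emb [F s d r] A x : rename.

(** * Adjoints and multi-matrix algebras *)

Section Adjoint.
Variable F : numClosedFieldType.

Lemma adjmxM m n p (A : 'M[F]_(m, n)) (B : 'M[F]_(n, p)) :
  (A *m B)^t* = B^t* *m A^t*.
Proof. by rewrite trmx_mul map_mxM. Qed.

Lemma adjmx_sum m n (I : finType) (A : I -> 'M[F]_(m, n)) :
  (\sum_i A i)^t* = \sum_i (A i)^t*.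
Proof. by rewrite !raddf_sum. Qed.

Lemma adjmxZ m n c (A : 'M[F]_(m, n)) : (c *: A)^t* = c^* *: A^t*.
Proof. by rewrite linearZ /= map_mxZ. Qed.

Lemma adjmx_scalar n (c : F) : (c%:M : 'M_n)^t* = c^*%:M.
Proof. by rewrite tr_scalar_mx map_scalar_mx. Qed.

Lemma scalar_mx0 n : 0%:M = 0 :> 'M[F]_n.
Proof. exact: raddf0. Qed.

Lemma scalar_mx_inj n (c c' : F) :
  (0 < n)%N -> c%:M = c'%:M :> 'M_n -> c = c'.
Proof.
by move=> n_gt0 /matrixP/(_ (Ordinal n_gt0) (Ordinal n_gt0)); rewrite !mxE eqxx.
Qed.

End Adjoint.

Section Multimatrix.
Variables (F : numClosedFieldType) (r : nat) (a : 'I_r -> nat).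
Implicit Types x y : multimatrix F a.

Lemma mmP x y : (forall i, x i = y i) -> x = y.
Proof. by move=> xy; apply/ffunP. Qed.

Lemma mm0E i : (0 : multimatrix F a) i = 0.
Proof. exact: ffunE. Qed.

Lemma mm1E i : (1 : multimatrix F a) i = 1%:M.
Proof. exact: ffunE. Qed.

Lemma mmDE x y i : (x + y) i = x i + y i.
Proof. exact: ffunE. Qed.

Lemma mmME x y i : (x * y) i = x i *m y i.
Proof. exact: ffunE. Qed.

Lemma mmZE c x i : (c *: x) i = c *: x i.
Proof. exact: ffunE. Qed.

Lemma mm_starE x i : mm_star x i = (x i)^t*.
Proof. exact: ffunE. Qed.

(** The element with component [S] in the summand [i], and 0 elsewhere. *)
Definition mm_single (i : 'I_r) (S : 'M[F]_(a i)) : multimatrix F a :=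
  [ffun i' => if eqVneq i i' is EqNotNeq e then
      castmx (congr1 a e, congr1 a e) S else 0].

Lemma mm_single_same i S : mm_single (i := i) S i = S.
Proof.
by rewrite ffunE; case: eqVneq => [e|/eqP//]; rewrite (eq_axiomK e) castmx_id.
Qed.

Lemma mm_single_diff i i' S : i != i' -> mm_single (i := i) S i' = 0.
Proof. by rewrite ffunE; case: eqVneq. Qed.

Lemma mm_star_single i S : mm_star (mm_single (i := i) S) = mm_single (S^t*).
Proof.
apply: mmP => i'; rewrite mm_starE; have [<-|ne] := eqVneq i i'.
  by rewrite !mm_single_same.
by rewrite !mm_single_diff // trmx0 map_mx0.
Qed.

End Multimatrix.

(** * Frames *)

Lemma sum_tag (V : nmodType) (m : nat) (J : 'I_m -> finType)
    (f : forall j, J j -> V) :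
  \sum_(x : {j : 'I_m & J j}) f (tag x) (tagged x) = \sum_j \sum_(y : J j) f j y.
Proof. by rewrite sig_big_dep. Qed.

Lemma sum_tag_pair (V : nmodType) (m : nat) (J I : 'I_m -> finType)
    (f : forall j, J j -> I j -> V) :
  \sum_(x : {j : 'I_m & (J j * I j)%type}) f (tag x) (tagged x).1 (tagged x).2 =
  \sum_j \sum_(y : J j) \sum_(s : I j) f j y s.
Proof.
rewrite (sum_tag (fun j (x : J j * I j) => f j x.1 x.2)) /=.
by apply: eq_bigr => j _; rewrite -(pair_bigA _ (fun y s => f j y s)).
Qed.

Section Frames.
Variable F : numClosedFieldType.

(** A frame decomposes the Hilbert space [F^N] orthogonally as a direct sum,
   over [i] and [x : I i], of copies of [F^(a i)]: the matrix [V i x] is the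
   isometric inclusion of the copy indexed by [x]. *)
Definition frame (N r : nat) (a : 'I_r -> nat) (I : 'I_r -> finType)
    (V : forall i, I i -> 'M[F]_(N, a i)) : Prop :=
  [/\ forall i x x', (V i x)^t* *m V i x' = (x == x')%:R%:M,
      forall i i' x x', i != i' -> (V i x)^t* *m V i' x' = 0
    & \sum_i \sum_x V i x *m (V i x)^t* = 1%:M].

Section Select.
Variables (N r : nat) (a : 'I_r -> nat) (I : 'I_r -> finType).
Variable V : forall i, I i -> 'M[F]_(N, a i).
Hypothesis frV : frame V.

(** By orthogonality of a frame, only the term of index [(i, x)] remains. *)
Lemma frame_selectr p (Y : forall i, I i -> 'M[F]_(p, a i)) i x :
  \sum_i' \sum_x' Y i' x' *m ((V x')^t* *m V x) = Y i x.
Proof.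
have [Vi Vo _] := frV.
rewrite (bigD1 i) //= [X in _ + X]big1 => [|i' ne]; last first.
  by rewrite big1 // => x' _; rewrite Vo ?mulmx0.
rewrite addr0 (bigD1 x) //= big1 => [|x' ne]; last first.
  by rewrite Vi (negPf ne) mul_mx_scalar scale0r.
by rewrite addr0 Vi eqxx mulmx1.
Qed.

End Select.

(** A frame is a unitary matrix whose columns are grouped by copies. *)
Lemma unitary_frame (N r : nat) (a : 'I_r -> nat) (I : 'I_r -> finType)
    (V : forall i, I i -> 'M[F]_(N, a i)) :
  unitary (fun (h : 'I_N) (x : {i : 'I_r & (I i * 'I_(a i))%type}) =>
    V (tag x) (tagged x).1 h (tagged x).2) <-> frame V.
Proof.
have sumE h h' : (\sum_i \sum_x V i x *m (V i x)^t*) h h' =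
   \sum_(x : {i : 'I_r & (I i * 'I_(a i))%type})
     V (tag x) (tagged x).1 h (tagged x).2 *
     (V (tag x) (tagged x).1 h' (tagged x).2)^*.
  rewrite (sum_tag_pair (fun i (x : I i) (e : 'I_(a i)) =>
    V i x h e * (V i x h' e)^*)).
  rewrite summxE; apply: eq_bigr => i _; rewrite summxE.
  by apply: eq_bigr => x _; rewrite mxE; apply: eq_bigr => e _; rewrite !mxE.
have isoE i i' x x' e e' : ((V i x)^t* *m V i' x') e e' =
    \sum_h (V i x h e)^* * V i' x' h e'.
  by rewrite mxE; apply: eq_bigr => h _; rewrite !mxE.
split=> [[W1 W2]|[Vi Vo V1]]; split.
- move=> i x x'; apply/matrixP => e e'.
  rewrite isoE (W2 (existT _ i (x, e)) (existT _ i (x', e'))) mxE.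
  by rewrite -tag_eqE /tag_eq /= eqxx tagged_asE xpair_eqE /=; do 2 case: (_ == _).
- move=> i i' x x' ne; apply/matrixP => e e'.
  rewrite isoE (W2 (existT _ i (x, e)) (existT _ i' (x', e'))) mxE.
  by rewrite -tag_eqE /tag_eq /= (negPf ne).
- by apply/matrixP => h h'; rewrite sumE W1 mxE.
- by move=> h h'; rewrite -sumE V1 mxE.
move=> [i [x e]] [i' [x' e']]; rewrite -tag_eqE /tag_eq /=.
case: eqVneq => [ii'|ne] /=; last by rewrite -isoE Vo // mxE.
subst i'; rewrite tagged_asE xpair_eqE /= -isoE Vi mxE.
by do 2 case: (_ == _).
Qed.

Lemma unitary_eq (I J : finType) (W W' : I -> J -> F) :
  W =2 W' -> unitary W -> unitary W'.
Proof.
by move=> e [W1 W2]; split=> [i i'|j j']; [rewrite -W1|rewrite -W2];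
   apply: eq_bigr => z _; rewrite !e.
Qed.

Lemma frame_of_unitary (N r : nat) (a : 'I_r -> nat) (I : 'I_r -> finType)
    (W : 'I_N -> {i : 'I_r & (I i * 'I_(a i))%type} -> F) :
  unitary W ->
  frame (fun i (x : I i) => \matrix_(h < N, e < a i) W h (existT _ i (x, e))).
Proof.
move=> uW; apply/unitary_frame; apply: unitary_eq uW => h [i [x e]] /=.
by rewrite mxE.
Qed.

(** The coordinate inclusions, for an enumeration of an orthonormal basis
   indexed by [{i & (I i * 'I_(a i))%type}]. *)
Definition std_frame (r : nat) (a : 'I_r -> nat) (I : 'I_r -> finType) i
    (x : I i) : 'M[F]_(#|{: {i : 'I_r & (I i * 'I_(a i))%type}}|, a i) :=
  \matrix_(h, e) (enum_val h == existT _ i (x, e))%:R.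

Lemma frame_std (r : nat) (a : 'I_r -> nat) (I : 'I_r -> finType) :
  frame (std_frame a (I := I)).
Proof.
apply: (frame_of_unitary (W := fun h x => (enum_val h == x)%:R)).
split=> [h h'|x x'].
  rewrite (bigD1 (enum_val h)) //= eqxx mul1r big1 ?addr0 => [|x ne].
    by rewrite (inj_eq enum_val_inj) eq_sym conjC_nat.
  by rewrite eq_sym (negPf ne) mul0r.
rewrite (bigD1 (enum_rank x)) //= big1 ?addr0 => [|h ne].
  by rewrite enum_rankK eqxx conjC_nat mul1r.
by case: eqP => [e|_]; [rewrite -e enum_valK eqxx in ne|rewrite conjC_nat mul0r].
Qed.

(** Decomposing further every summand of a decomposition. *)
Definition comp_frame (N m n : nat) (b : 'I_m -> nat) (a : 'I_n -> nat)
    (I : 'I_m -> finType) (J : 'I_m -> 'I_n -> finType)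
    (V : forall j, I j -> 'M[F]_(N, b j))
    (W : forall j i, J j i -> 'M[F]_(b j, a i))
    i (x : {j : 'I_m & (J j i * I j)%type}) : 'M[F]_(N, a i) :=
  V (tag x) (tagged x).2 *m W (tag x) i (tagged x).1.

Lemma frame_comp (N m n : nat) (b : 'I_m -> nat) (a : 'I_n -> nat)
    (I : 'I_m -> finType) (J : 'I_m -> 'I_n -> finType)
    (V : forall j, I j -> 'M[F]_(N, b j))
    (W : forall j i, J j i -> 'M[F]_(b j, a i)) :
  frame V -> (forall j, frame (W j)) -> frame (comp_frame V W).
Proof.
move=> [Vi Vo V1] frW; split.
- move=> i [j [y s]] [j' [y' s']]; rewrite /comp_frame /= -tag_eqE /tag_eq /=.
  rewrite adjmxM mulmxA -(mulmxA _ (_^t*)); case: eqVneq => [e|ne] /=; last first.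
    by rewrite Vo // mulmx0 mul0mx scalar_mx0.
  subst j'; rewrite tagged_asE xpair_eqE /= Vi mul_mx_scalar -scalemxAl.
  by have [-> _ _] := frW j; rewrite scale_scalar_mx -natrM mulnb andbC.
- move=> i i' [j [y s]] [j' [y' s']] ne; rewrite /comp_frame /=.
  rewrite adjmxM mulmxA -(mulmxA _ (_^t*)); have [e|ne'] := eqVneq j j'; last first.
    by rewrite Vo // mulmx0 mul0mx.
  subst j'; rewrite Vi mul_mx_scalar -scalemxAl.
  by have [_ -> // _] := frW j; rewrite scaler0.
rewrite -V1.
under eq_bigr => i _.
  rewrite (sum_tag_pair
    (fun j y s => V j s *m W j i y *m (V j s *m W j i y)^t*)).
  over.
rewrite exchange_big; apply: eq_bigr => j _.
under eq_bigr do rewrite exchange_big.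
rewrite exchange_big; apply: eq_bigr => s _ /=.
have [_ _ W1] := frW j.
rewrite -[X in _ = X *m _]mulmx1 -W1 mulmx_sumr mulmx_suml; apply: eq_bigr => i _.
rewrite mulmx_sumr mulmx_suml; apply: eq_bigr => y _.
by rewrite adjmxM !mulmxA.
Qed.

(** Changing the decomposition inside every isotypical component. *)
Definition rot_frame (N n : nat) (a : 'I_n -> nat) (X Y : 'I_n -> finType)
    (u : forall i, X i -> Y i -> F) (Z : forall i, X i -> 'M[F]_(N, a i))
    i (y : Y i) : 'M[F]_(N, a i) := \sum_x u i x y *: Z i x.

Lemma frame_rot_overlap (N n : nat) (a : 'I_n -> nat) (X Y : 'I_n -> finType)
    (u : forall i, X i -> Y i -> F) (Z : forall i, X i -> 'M[F]_(N, a i)) i x y :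
  frame Z -> (Z i x)^t* *m rot_frame u Z y = (u i x y)%:M.
Proof.
move=> [Zi _ _]; rewrite mulmx_sumr (bigD1 x) //= big1 => [|x' ne].
  by rewrite -scalemxAr Zi eqxx scale_scalar_mx mulr1 addr0.
by rewrite -scalemxAr Zi eq_sym (negPf ne) scalar_mx0 scaler0.
Qed.

Lemma frame_rot_ortho (N n : nat) (a : 'I_n -> nat) (X Y : 'I_n -> finType)
    (u : forall i, X i -> Y i -> F) (Z : forall i, X i -> 'M[F]_(N, a i))
    i i' x y :
  frame Z -> i != i' -> (Z i x)^t* *m rot_frame u Z (y : Y i') = 0.
Proof.
move=> [_ Zo _] ne; rewrite mulmx_sumr big1 // => x' _.
by rewrite -scalemxAr Zo // scaler0.
Qed.

(** The new copies carry the same operators on the isotypical component. *)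
Lemma rot_frame_sandwich (N n : nat) (a : 'I_n -> nat) (X Y : 'I_n -> finType)
    (u : forall i, X i -> Y i -> F) (Z : forall i, X i -> 'M[F]_(N, a i)) i
    (S : 'M[F]_(a i)) :
  unitary (u i) ->
  \sum_y rot_frame u Z y *m S *m (rot_frame u Z (y : Y i))^t* =
  \sum_x Z i x *m S *m (Z i x)^t*.
Proof.
move=> [u1 _]; rewrite /rot_frame.
under eq_bigr => y _.
  rewrite adjmx_sum -mulmxA mulmx_suml.
  under eq_bigr => x _.
    rewrite !mulmx_sumr; under eq_bigr => x' _ do
      rewrite adjmxZ -!scalemxAr -!scalemxAl scalerA.
    over.
  over.
rewrite exchange_big; apply: eq_bigr => x _; rewrite exchange_big /=.
under eq_bigr => x' _.
  rewrite -scaler_suml; under eq_bigr do rewrite mulrC.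
  rewrite u1; over.
rewrite (bigD1 x) //= eqxx scale1r mulmxA big1 ?addr0 // => x' ne.
by rewrite eq_sym (negPf ne) scale0r.
Qed.

Lemma frame_rot (N n : nat) (a : 'I_n -> nat) (X Y : 'I_n -> finType)
    (u : forall i, X i -> Y i -> F) (Z : forall i, X i -> 'M[F]_(N, a i)) :
  frame Z -> (forall i, unitary (u i)) -> frame (rot_frame u Z).
Proof.
move=> frZ uu; have [_ _ Z1] := frZ; split.
- move=> i y y'; rewrite {1}/rot_frame adjmx_sum mulmx_suml.
  under eq_bigr do rewrite adjmxZ -scalemxAl frame_rot_overlap // scale_scalar_mx.
  by rewrite -raddf_sum /=; have [_ ->] := uu i.
- move=> i i' y y' ne; rewrite {1}/rot_frame adjmx_sum mulmx_suml big1 // => x _.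
  by rewrite adjmxZ -scalemxAl frame_rot_ortho // scaler0.
rewrite -Z1; apply: eq_bigr => i _.
have := rot_frame_sandwich Z 1%:M (uu i).
by under eq_bigr do rewrite mulmx1; under [in RHS]eq_bigr do rewrite mulmx1.
Qed.

(** Regrouping the summands of a decomposition: a partial inverse to
   [comp_frame]. *)
Definition group_frame (N m n : nat) (b : 'I_m -> nat) (a : 'I_n -> nat)
    (I : 'I_m -> finType) (J : 'I_m -> 'I_n -> finType)
    (Z : forall i, {j : 'I_m & (J j i * I j)%type} -> 'M[F]_(N, a i))
    (W : forall j i, J j i -> 'M[F]_(b j, a i)) j (s : I j) : 'M[F]_(N, b j) :=
  \sum_i \sum_(y : J j i) Z i (existT _ j (y, s)) *m (W j i y)^t*.

Section Group.
Variables (N m n : nat) (b : 'I_m -> nat) (a : 'I_n -> nat).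
Variables (I : 'I_m -> finType) (J : 'I_m -> 'I_n -> finType).
Variable Z : forall i, {j : 'I_m & (J j i * I j)%type} -> 'M[F]_(N, a i).
Variable W : forall j i, J j i -> 'M[F]_(b j, a i).
Arguments Z : clear implicits.
Arguments W : clear implicits.
Hypotheses (frZ : frame Z) (frW : forall j, frame (W j)).

Lemma comp_group_frame i x : comp_frame (group_frame Z W) W x = Z i x.
Proof.
case: x => j [y s]; rewrite /comp_frame /group_frame /= mulmx_suml.
under eq_bigr => i' _.
  rewrite mulmx_suml; under eq_bigr do rewrite -mulmxA.
  over.
exact: (frame_selectr (frW j) (fun i' y' => Z i' (existT _ j (y', s)))).
Qed.

Lemma frame_group : frame (group_frame Z W).
Proof.
have [Zi Zo Z1] := frZ.
have adjE j s : (group_frame Z W s)^t* =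
    \sum_i \sum_(y : J j i) W j i y *m (Z i (existT _ j (y, s)))^t*.
  rewrite adjmx_sum; apply: eq_bigr => i _; rewrite adjmx_sum.
  by apply: eq_bigr => y _; rewrite adjmxM trmxCK.
have prodE j j' s s' : (group_frame Z W s)^t* *m group_frame Z W s' =
    \sum_i \sum_(y : J j i) W j i y *m
      \sum_(y' : J j' i) ((Z i (existT _ j (y, s)))^t* *m
         Z i (existT _ j' (y', s')) *m (W j' i y')^t*).
  rewrite adjE mulmx_suml; apply: eq_bigr => i _.
  rewrite mulmx_suml; apply: eq_bigr => y _.
  rewrite -mulmxA; congr (_ *m _); rewrite mulmx_sumr (bigD1 i) //=.
  rewrite [X in _ + X]big1 ?addr0 => [|i' ne].
    by rewrite mulmx_sumr; apply: eq_bigr => y' _; rewrite mulmxA.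
  by rewrite mulmx_sumr big1 // => y' _; rewrite mulmxA Zo ?mul0mx // eq_sym.
split.
- move=> j s s'; rewrite prodE; have [_ _ W1] := frW j.
  rewrite -scalemx1 -W1 scaler_sumr; apply: eq_bigr => i _.
  rewrite scaler_sumr; apply: eq_bigr => y _; rewrite scalemxAr; congr (_ *m _).
  rewrite (bigD1 y) //= big1 ?addr0 => [|y' ne].
    rewrite Zi -tag_eqE /tag_eq /= eqxx tagged_asE xpair_eqE eqxx /=.
    by rewrite mul_scalar_mx.
  rewrite Zi -tag_eqE /tag_eq /= eqxx tagged_asE xpair_eqE eq_sym (negPf ne) /=.
  by rewrite mul_scalar_mx scale0r.
- move=> j j' s s' ne; rewrite prodE big1 // => i _; rewrite big1 // => y _.
  rewrite big1 ?mulmx0 // => y' _.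
  by rewrite Zi -tag_eqE /tag_eq /= (negPf ne) /= mul_scalar_mx scale0r.
rewrite -Z1.
under [in RHS]eq_bigr => i _.
  under eq_bigr => x _ do rewrite -comp_group_frame.
  rewrite (sum_tag_pair (fun j y s => group_frame Z W s *m W j i y *m
    (group_frame Z W s *m W j i y)^t*)).
  over.
rewrite [in RHS]exchange_big /=; apply: eq_bigr => j _.
under [in RHS]eq_bigr do rewrite exchange_big.
rewrite [in RHS]exchange_big; apply: eq_bigr => s _ /=.
have [_ _ W1] := frW j.
rewrite -[X in X *m _ = _]mulmx1 -W1 mulmx_sumr mulmx_suml.
apply: eq_bigr => i _.
rewrite mulmx_sumr mulmx_suml; apply: eq_bigr => y _.
by rewrite adjmxM !mulmxA.
Qed.

End Group.
End Frames.

(** * Traces *)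

Section MultimatrixLinear.
Variables (F : numClosedFieldType) (r : nat) (a : 'I_r -> nat).
Implicit Types x y : multimatrix F a.

Lemma mm_sumE (I : finType) (x : I -> multimatrix F a) i :
  (\sum_j x j) i = \sum_j x j i.
Proof.
by elim/big_rec2: _ => [|j _ y _ <-]; rewrite ?mm0E ?mmDE.
Qed.

Lemma mm_scaleAl c x y : (c *: x) * y = c *: (x * y).
Proof. by apply: mmP => i; rewrite !(mmME, mmZE) -scalemxAl. Qed.

Lemma mm_single_linear i : linear (mm_single (F := F) (a := a) (i := i)).
Proof.
move=> c S S'; apply: mmP => i'; rewrite mmDE mmZE.
have [<-|ne] := eqVneq i i'; first by rewrite !mm_single_same.
by rewrite !mm_single_diff // scaler0 addr0.
Qed.

HB.instance Definition _ i := GRing.isLinear.Build F 'M[F]_(a i)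
  (multimatrix F a) _ (@mm_single F r a i) (@mm_single_linear i).

Lemma mm_singleM i (S S' : 'M[F]_(a i)) :
  mm_single S * mm_single S' = mm_single (S *m S').
Proof.
apply: mmP => i'; rewrite mmME.
have [<-|ne] := eqVneq i i'; first by rewrite !mm_single_same.
by rewrite !mm_single_diff // mulmx0.
Qed.

Lemma mm_sum_single x : x = \sum_i mm_single (x i).
Proof.
apply: mmP => i; rewrite mm_sumE (bigD1 i) //= mm_single_same big1 ?addr0 //.
by move=> i' ne; rewrite mm_single_diff.
Qed.

End MultimatrixLinear.

Section Trace.
Variable F : numClosedFieldType.

Lemma mxtrace_adj m n (A : 'M[F]_(m, n)) :
  \tr (A^t* *m A) = \sum_j \sum_i `|A i j| ^+ 2.
Proof.
apply: eq_bigr => j _; rewrite mxE; apply: eq_bigr => i _.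
by rewrite !mxE normCK mulrC.
Qed.

Lemma mxtrace_adj_ge0 m n (A : 'M[F]_(m, n)) : 0 <= \tr (A^t* *m A).
Proof.
rewrite mxtrace_adj sumr_ge0 // => j _.
by rewrite sumr_ge0 // => i _; rewrite exprn_ge0.
Qed.

Lemma mxtrace_adj_eq0 m n (A : 'M[F]_(m, n)) : \tr (A^t* *m A) = 0 -> A = 0.
Proof.
rewrite mxtrace_adj => /eqP; rewrite psumr_eq0 => [/allP A0|j _]; last first.
  by rewrite sumr_ge0 // => i _; rewrite exprn_ge0.
apply/matrixP => i j; have /implyP/(_ isT) := A0 j (mem_index_enum j).
rewrite psumr_eq0 => [/allP/(_ i (mem_index_enum i))/=|i' _]; last exact: exprn_ge0.
by rewrite expf_eq0 /= normr_eq0 mxE => /eqP.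
Qed.

Variables (s : nat) (d : 'I_s -> nat).
Implicit Types (x y : multimatrix F d) (delta : 'I_s -> F).

(** The trace with weights [delta]. *)
Definition wtrace delta x : F := \sum_k delta k * \tr (x k).

Lemma wtrace_linear delta : scalar (wtrace delta).
Proof.
move=> c x y; rewrite mulr_sumr -big_split; apply: eq_bigr => k _ /=.
by rewrite mmDE mmZE mxtraceD mxtraceZ mulrDr mulrCA.
Qed.

Lemma wtraceC delta x y : wtrace delta (x * y) = wtrace delta (y * x).
Proof. by apply: eq_bigr => k _; rewrite !mmME mxtrace_mulC. Qed.

Lemma faithful_wtrace delta :
  (forall k, 0 < delta k) -> faithful_trace (wtrace delta).
Proof.
move=> d_gt0; split; [exact: wtrace_linear | exact: wtraceC |] => x x0.
have ge0 k : 0 <= delta k * \tr ((mm_star x * x) k).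
  by rewrite mmME mm_starE mulr_ge0 ?mxtrace_adj_ge0 // ltW.
rewrite lt_def sumr_ge0 // andbT; apply: contraNneq x0 => /eqP.
rewrite psumr_eq0 // => /allP tr0; apply/eqP; apply: mmP => k; rewrite mm0E.
have /implyP/(_ isT) := tr0 k (mem_index_enum k).
rewrite mulf_eq0 gt_eqF //= mmME mm_starE => /eqP; exact: mxtrace_adj_eq0.
Qed.

Lemma faithful_traceE (d_gt0 : forall k, (0 < d k)%N) tr :
  faithful_trace tr ->
  exists2 delta, forall k, 0 < delta k & tr =1 wtrace delta.
Proof.
case=> trL trC tr_gt0.
have tr0 : tr 0 = 0.
  by have := trL (- 1) 0 0; rewrite scaler0 addr0 mulN1r addNr.
have trD x y : tr (x + y) = tr x + tr y.
  by have := trL 1 x y; rewrite scale1r mul1r.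
have trZ c x : tr (c *: x) = c * tr x.
  by have := trL c x 0; rewrite tr0 !addr0.
have tr_sum (J : finType) (f : J -> multimatrix F d) :
  tr (\sum_j f j) = \sum_j tr (f j) by exact: big_morph.
pose o k : 'I_(d k) := Ordinal (d_gt0 k).
pose e k a b : multimatrix F d := mm_single (delta_mx a b : 'M_(d k)).
have trE k a b : tr (e k a b) = (a == b)%:R * tr (e k (o k) (o k)).
  have -> : e k a b = e k a (o k) * e k (o k) b.
    by rewrite mm_singleM mul_delta_mx.
  rewrite trC mm_singleM -trZ mul_delta_mx_cond eq_sym; congr tr.
  by case: eqP => _; rewrite ?scale1r // scale0r mulr0n; apply: mmP => i;
    have [<-|ne] := eqVneq k i;
    rewrite mm0E ?mm_single_same ?mm_single_diff.
exists (fun k => tr (e k (o k) (o k))) => [k|x].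
  have -> : e k (o k) (o k) = mm_star (e k (o k) (o k)) * e k (o k) (o k).
    by rewrite mm_star_single trmx_delta map_delta_mx mm_singleM mul_delta_mx.
  apply: tr_gt0; apply/eqP => /ffunP/(_ k)/eqP; rewrite mm_single_same mm0E.
  move/eqP/matrixP/(_ (o k) (o k)); rewrite !mxE !eqxx => /eqP.
  by rewrite oner_eq0.
rewrite [in LHS](mm_sum_single x) tr_sum; apply: eq_bigr => k _.
rewrite [x k]matrix_sum_delta.
rewrite linear_sum tr_sum.
rewrite -matrix_sum_delta mulr_sumr; apply: eq_bigr => a _.
rewrite linear_sum tr_sum (bigD1 a) //= linearZ trZ [tr _]trE eqxx mul1r mulrC.
rewrite big1 ?addr0 // => b ne.
by rewrite linearZ trZ [tr _]trE eq_sym (negPf ne) mul0r mulr0.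
Qed.

End Trace.

(** * Subalgebras and conditional expectations *)

Section Subalgebra.
Variables (F : numClosedFieldType) (s : nat) (d : 'I_s -> nat).
Variables (r : nat) (A : mmsub F d r).

Lemma ms_setP x : ms_set A x <-> exists y, ms_emb A y = x.
Proof. by split=> [[y _ <-]|[y <-]]; [exists y | exists y]. Qed.

Lemma ms_set_emb y : ms_set A (ms_emb A y).
Proof. by exists y. Qed.

Lemma ms_set1 : ms_set A 1.
Proof. by rewrite -(se_one (ms_embP A)); exact: ms_set_emb. Qed.

Lemma ms_setM x y : ms_set A x -> ms_set A y -> ms_set A (x * y).
Proof.
move=> /ms_setP[x' <-] /ms_setP[y' <-].
by rewrite -(se_mul (ms_embP A)); exact: ms_set_emb.
Qed.

Lemma ms_set_lin c x y : ms_set A x -> ms_set A y -> ms_set A (c *: x + y).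
Proof.
move=> /ms_setP[x' <-] /ms_setP[y' <-].
by rewrite -(se_linear (ms_embP A)); exact: ms_set_emb.
Qed.

Lemma ms_set_star x : ms_set A x -> ms_set A (mm_star x).
Proof.
by move=> /ms_setP[x' <-]; rewrite -(se_star (ms_embP A)); exact: ms_set_emb.
Qed.

Variable tr : multimatrix F d -> F.
Hypothesis trP : faithful_trace tr.

(** A faithful trace separates the points of a *-subalgebra. *)
Lemma tr_separates x y :
  ms_set A x -> ms_set A y ->
  (forall z, ms_set A z -> tr (x * z) = tr (y * z)) -> x = y.
Proof.
move=> Ax Ay xy; apply/eqP; rewrite -subr_eq0; apply/negP => /negP ne.
have trB u v : tr (u - v) = tr u - tr v.
  by rewrite addrC -scaleN1r (ft_linear trP) mulN1r addrC.
have Az : ms_set A (mm_star (x - y)).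
  by apply: ms_set_star; rewrite addrC -scaleN1r; exact: ms_set_lin.
have := ft_gt0 trP ne.
by rewrite (ft_mulC trP) mulrBl trB xy // subrr ltxx.
Qed.

Lemma cond_exp_tr E x z :
  cond_exp tr A E -> ms_set A z -> tr (E x * z) = tr (x * z).
Proof.
move=> EP Az; rewrite -(ce_tr EP (x * z)).
by rewrite -[in RHS](mul1r x) (ce_bimod EP) ?mul1r //; exact: ms_set1.
Qed.

Lemma cond_exp_adj E x y :
  cond_exp tr A E -> tr (E x * y) = tr (x * E y).
Proof.
move=> EP; rewrite (ft_mulC trP) -(cond_exp_tr y EP (ce_range EP x)).
by rewrite (ft_mulC trP) (cond_exp_tr x EP (ce_range EP y)).
Qed.

Lemma cond_exp_unique E E' :
  cond_exp tr A E -> cond_exp tr A E' -> E =1 E'.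
Proof.
move=> EP EP' x; apply: tr_separates => [||z Az].
- exact: (ce_range EP).
- exact: (ce_range EP').
by rewrite !(@cond_exp_tr _ _ z).
Qed.

(** The algebraic properties of a conditional expectation follow from its
   defining property with respect to the trace; only positivity does not. *)
Lemma cond_exp_of_tr E :
  (forall x, ms_set A (E x)) ->
  (forall x z, ms_set A z -> tr (E x * z) = tr (x * z)) ->
  (forall x, mm_psd x -> mm_psd (E x)) -> cond_exp tr A E.
Proof.
move=> Er Et Ep; split=> // [c x y|x Ax|x y z Ax Az|x].
- apply: tr_separates => [||z Az] //; first exact: ms_set_lin.
  by rewrite Et // !mulrDl !mm_scaleAl !(ft_linear trP) !Et.
- by apply: tr_separates => // z Az; rewrite Et.
- apply: tr_separates => // [|t At]; first by apply: ms_setM => //; apply: ms_setM.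
  rewrite Et // -!mulrA !(ft_mulC trP x) -!mulrA Et //.
  by do 2![apply: ms_setM => //].
by rewrite -[E x]mulr1 Et ?mulr1 //; exact: ms_set1.
Qed.

End Subalgebra.

(** * Embeddings given by frames *)

Section FrameEmb.
Variables (F : numClosedFieldType) (s r : nat).
Variables (d : 'I_s -> nat) (a : 'I_r -> nat) (I : 'I_s -> 'I_r -> finType).
Variable V : forall k i, I k i -> 'M[F]_(d k, a i).
Arguments V : clear implicits.

(** The block diagonal embedding with respect to a family of frames, one for
   each summand of the target. *)
Definition frame_emb (y : multimatrix F a) : multimatrix F d :=
  [ffun k => \sum_i \sum_x V k i x *m y i *m (V k i x)^t*].

Lemma frame_embE y k :
  frame_emb y k = \sum_i \sum_x V k i x *m y i *m (V k i x)^t*.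
Proof. exact: ffunE. Qed.

Lemma frame_emb_linear : linear frame_emb.
Proof.
move=> c y z; apply: mmP => k; rewrite mmDE mmZE !frame_embE.
rewrite scaler_sumr -big_split; apply: eq_bigr => i _ /=.
rewrite scaler_sumr -big_split; apply: eq_bigr => x _ /=.
by rewrite mmDE mmZE mulmxDr mulmxDl -scalemxAr -scalemxAl.
Qed.

Lemma frame_emb_star y : frame_emb (mm_star y) = mm_star (frame_emb y).
Proof.
apply: mmP => k; rewrite mm_starE !frame_embE adjmx_sum; apply: eq_bigr => i _.
rewrite adjmx_sum; apply: eq_bigr => x _.
by rewrite !adjmxM trmxCK mm_starE mulmxA.
Qed.

Lemma psd_frame_emb y : mm_psd y -> mm_psd (frame_emb y).
Proof.
move=> y_ge0 k w; rewrite frame_embE mulmx_sumr mulmx_suml summxE.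
apply: sumr_ge0 => i _; rewrite mulmx_sumr mulmx_suml summxE.
apply: sumr_ge0 => x _; have := y_ge0 i ((V k i x)^t* *m w).
by rewrite adjmxM trmxCK !mulmxA.
Qed.

Hypothesis frV : forall k, frame (V k).

Lemma frame_embMr y k i x : frame_emb y k *m V k i x = V k i x *m y i.
Proof.
rewrite frame_embE mulmx_suml.
under eq_bigr => i' _.
  rewrite mulmx_suml; under eq_bigr do rewrite -(mulmxA (_ *m _)).
  over.
exact: (frame_selectr (frV k) (fun i' x' => V k i' x' *m y i')).
Qed.

Lemma frame_emb_coord y k i x :
  (V k i x)^t* *m frame_emb y k *m V k i x = y i.
Proof.
by rewrite -mulmxA frame_embMr mulmxA; have [-> _ _] := frV k; rewrite eqxx mul1mx.
Qed.

Lemma frame_emb1 : frame_emb 1 = 1.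
Proof.
apply: mmP => k; rewrite frame_embE mm1E; have [_ _ <-] := frV k.
by apply: eq_bigr => i _; apply: eq_bigr => x _; rewrite mm1E mulmx1.
Qed.

Lemma frame_embM : {morph frame_emb : y z / y * z}.
Proof.
move=> y z; apply: mmP => k; rewrite mmME [in LHS]frame_embE [X in _ *m X]frame_embE.
rewrite mulmx_sumr; apply: eq_bigr => i _; rewrite mulmx_sumr.
by apply: eq_bigr => x _; rewrite mmME !mulmxA frame_embMr.
Qed.

Lemma star_embedding_frame :
  (forall i, exists k, (0 < #|I k i|)%N) -> star_embedding frame_emb.
Proof.
move=> I_gt0; split; [exact: frame_emb_linear | exact: frame_embM
  | exact: frame_emb1 | exact: frame_emb_star |] => y z yz.
apply: mmP => i; have [k /card_gt0P[x _]] := I_gt0 i.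
by rewrite -(frame_emb_coord y x) yz frame_emb_coord.
Qed.

(** An embedding whose summands restrict as prescribed by the frames is the
   block diagonal one. *)
Lemma frame_emb_unique (y : multimatrix F a) (z : multimatrix F d) k :
  (forall i x, z k *m V k i x = V k i x *m y i) -> z k = frame_emb y k.
Proof.
move=> yz; rewrite frame_embE -[LHS]mulmx1; have [_ _ <-] := frV k.
rewrite mulmx_sumr; apply: eq_bigr => i _; rewrite mulmx_sumr.
by apply: eq_bigr => x _; rewrite mulmxA yz.
Qed.

Variable delta : 'I_s -> F.

(** The trace weights on the subalgebra. *)
Definition weight (i : 'I_r) : F := \sum_k delta k * #|I k i|%:R.

Lemma wtrace_frame_emb y : wtrace delta (frame_emb y) = wtrace weight y.
Proof.
rewrite /wtrace; under eq_bigr => k _ do rewrite frame_embE raddf_sum mulr_sumr.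
rewrite exchange_big; apply: eq_bigr => i _ /=.
rewrite mulr_suml; apply: eq_bigr => k _; rewrite -mulrA; congr (_ * _).
rewrite raddf_sum /= -sum1_card natr_sum mulr_suml; apply: eq_bigr => x _.
by rewrite mxtrace_mulC mulmxA; have [-> _ _] := frV k; rewrite eqxx mul1mx mul1r.
Qed.

(** The trace-preserving conditional expectation, in the coordinates of the
   subalgebra: average the compressions to the copies of each summand. *)
Definition cexp_coord (z : multimatrix F d) : multimatrix F a :=
  [ffun i => (weight i)^-1 *:
     \sum_k delta k *: \sum_x (V k i x)^t* *m z k *m V k i x].

Definition cexp (z : multimatrix F d) := frame_emb (cexp_coord z).

Hypothesis weight_gt0 : forall i, 0 < weight i.

Lemma wtrace_cexp z y :
  wtrace delta (cexp z * frame_emb y) = wtrace delta (z * frame_emb y).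
Proof.
rewrite -frame_embM wtrace_frame_emb /wtrace.
under [in RHS]eq_bigr => k _.
  rewrite mmME frame_embE mulmx_sumr raddf_sum mulr_sumr; over.
rewrite exchange_big; apply: eq_bigr => i _ /=.
rewrite mmME ffunE -scalemxAl mxtraceZ mulrA divff ?gt_eqF // mul1r.
rewrite mulmx_suml raddf_sum; apply: eq_bigr => k _ /=.
rewrite -scalemxAl mxtraceZ; congr (_ * _).
rewrite mulmx_suml mulmx_sumr !raddf_sum; apply: eq_bigr => x _ /=.
by rewrite !mulmxA [RHS]mxtrace_mulC !mulmxA.
Qed.

Hypothesis delta_gt0 : forall k, 0 < delta k.

Lemma psd_cexp z : mm_psd z -> mm_psd (cexp z).
Proof.
move=> z_ge0; apply: psd_frame_emb => i w; rewrite ffunE.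
rewrite -scalemxAr -scalemxAl mxE mulr_ge0 ?invr_ge0 ?(ltW (weight_gt0 i)) //.
rewrite mulmx_sumr mulmx_suml summxE sumr_ge0 // => k _.
rewrite -scalemxAr -scalemxAl mxE mulr_ge0 ?(ltW (delta_gt0 k)) //.
rewrite mulmx_sumr mulmx_suml summxE sumr_ge0 // => x _.
by have := z_ge0 k (V k i x *m w); rewrite adjmxM !mulmxA.
Qed.

End FrameEmb.

Lemma cond_exp_cexp (F : numClosedFieldType) (s r : nat) (d : 'I_s -> nat)
    (A : mmsub F d r) (I : 'I_s -> 'I_r -> finType)
    (V : forall k i, I k i -> 'M[F]_(d k, ms_dim A i)) (delta : 'I_s -> F) :
  (forall k, 0 < delta k) -> (forall i, 0 < weight I delta i) ->
  (forall k, frame (V k)) -> ms_emb A =1 frame_emb V ->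
  cond_exp (wtrace delta) A (cexp V delta).
Proof.
move=> d_gt0 w_gt0 frV AV; apply: cond_exp_of_tr.
- exact: faithful_wtrace.
- by move=> x; rewrite /cexp -AV; exact: ms_set_emb.
- by move=> x z /ms_setP[y <-]; rewrite AV wtrace_cexp.
exact: psd_cexp.
Qed.

Lemma scale_sum_exchange (F : fieldType) (M : lmodType F) (K P : finType)
    (S T : K -> finType) (w : K -> F) (c : forall k, S k -> T k -> P -> F)
    (f : P -> M) :
  \sum_k w k *: \sum_(s : S k) \sum_(t : T k) \sum_p c k s t p *: f p =
  \sum_p (\sum_k w k * \sum_(s : S k) \sum_(t : T k) c k s t p) *: f p.
Proof.
under [in RHS]eq_bigr do rewrite scaler_suml.
rewrite [in RHS]exchange_big; apply: eq_bigr => k _ /=.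
under [in RHS]eq_bigr do rewrite -scalerA scaler_suml.
rewrite -[in RHS]scaler_sumr [in RHS]exchange_big; congr (_ *: _).
apply: eq_bigr => s _ /=.
under [in RHS]eq_bigr do rewrite scaler_suml.
by rewrite [in RHS]exchange_big.
Qed.

(** * The conditional expectations in coordinates *)

(* [W] and [W'] are the frames of the inclusions of [A] in [B] and in [C], [V]
   and [V'] those of the inclusions of [B] and [C] in [D]; the block sizes of
   these algebras are [a], [b], [c], [d]. *)
Section Core.
Variables (F : numClosedFieldType) (n m p q : nat).
Variables (a : 'I_n -> nat) (b : 'I_m -> nat) (c : 'I_p -> nat) (d : 'I_q -> nat).
Variables (G : 'I_m -> 'I_n -> finType) (H : 'I_q -> 'I_m -> finType).
Variables (K : 'I_p -> 'I_n -> finType) (L : 'I_q -> 'I_p -> finType).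
Variable W : forall j i, G j i -> 'M[F]_(b j, a i).
Variable V : forall k j, H k j -> 'M[F]_(d k, b j).
Variable W' : forall l i, K l i -> 'M[F]_(c l, a i).
Variable V' : forall k l, L k l -> 'M[F]_(d k, c l).
Arguments W : clear implicits.
Arguments V : clear implicits.
Arguments W' : clear implicits.
Arguments V' : clear implicits.
Hypotheses (frW : forall j, frame (W j)) (frW' : forall l, frame (W' l)).
Variable u : forall i j k l, G j i -> H k j -> K l i -> L k l -> F.
Arguments u : clear implicits.

(** The transition matrix between the two decompositions of the summand [k]
   of the large algebra into copies of the summands of the small one is, on
   the copies of the summand [i], [u i _ k _] tensored with the identity, and 0
   between copies of different summands. *)
Definition overlap : Prop :=
  (forall i j k l y s z t,
    (W j i y)^t* *m ((V k j s)^t* *m V' k l t) *m W' l i z =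
    (u i j k l y s z t)%:M) /\
  (forall i i' j k l y s z t, i != i' ->
    (W j i y)^t* *m ((V k j s)^t* *m V' k l t) *m W' l i' z = 0).

Hypothesis ovl : overlap.

Lemma overlap_expand k j l (s : H k j) (t : L k l) :
  (V k j s)^t* *m V' k l t =
  \sum_(x : {i : 'I_n & (G j i * K l i)%type})
    u (tag x) j k l (tagged x).1 s (tagged x).2 t
    *: (W j (tag x) (tagged x).1 *m (W' l (tag x) (tagged x).2)^t*).
Proof.
have [ov1 ov2] := ovl.
rewrite (sum_tag_pair (fun i (y : G j i) (z : K l i) =>
  u i j k l y s z t *: (W j i y *m (W' l i z)^t*))).
have [_ _ W1] := frW j; have [_ _ W'1] := frW' l.
set P := _ *m _; rewrite -[LHS]mul1mx -W1 mulmx_suml; apply: eq_bigr => i _.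
rewrite mulmx_suml; apply: eq_bigr => y _.
rewrite -[LHS]mulmx1 -W'1 mulmx_sumr (bigD1 i) //= [X in _ + X]big1; last first.
  move=> i' ne; rewrite mulmx_sumr big1 // => z _.
  have := ov2 i i' j k l y s z t; rewrite eq_sym => /(_ ne); rewrite -/P => e.
  by rewrite mulmxA -!(mulmxA (W j i y)) e mul0mx mulmx0.
rewrite addr0 mulmx_sumr; apply: eq_bigr => z _.
by rewrite mulmxA -!(mulmxA (W j i y)) ov1 mul_scalar_mx scalemxAr.
Qed.

Variable delta : 'I_q -> F.
Local Notation beta := (weight H delta).
Local Notation gamma := (weight L delta).
Local Notation alpha := (weight K gamma).
Hypothesis beta_gt0 : forall j, 0 < beta j.

(** The Gram matrix of the rows of [v j l], up to the normalizing factors. *)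
Definition gram j l (x x' : {i : 'I_n & (G j i * K l i)%type}) : F :=
  \sum_k delta k * \sum_(s : H k j) \sum_(t : L k l)
    u (tag x) j k l (tagged x).1 s (tagged x).2 t *
    (u (tag x') j k l (tagged x').1 s (tagged x').2 t)^*.

(** The summands in the expansion of the transition matrix over the index set
   of the rows of [v j l]. *)
Let M j l (x : {i : 'I_n & (G j i * K l i)%type}) : 'M[F]_(b j, c l) :=
  W j (tag x) (tagged x).1 *m (W' l (tag x) (tagged x).2)^t*.

Lemma cexp_coord_gram (z : multimatrix F c) j :
  cexp_coord V delta (frame_emb V' z) j =
  (beta j)^-1 *: \sum_l \sum_x \sum_x'
     gram x x' *: (M x *m z l *m (M (x' : {i : 'I_n & (G j i * K l i)%type}))^t*).
Proof.
rewrite ffunE; congr (_ *: _).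
under eq_bigr => k _.
  under eq_bigr => s _.
    rewrite frame_embE mulmx_sumr mulmx_suml; over.
  rewrite exchange_big scaler_sumr; over.
rewrite exchange_big; apply: eq_bigr => l _ /=.
rewrite (pair_bigA _ (fun x x' => gram x x' *: (M x *m z l *m (M x')^t*))) /=.
rewrite -[RHS](scale_sum_exchange delta (fun k s t
  (x : {i : 'I_n & (G j i * K l i)%type} * {i : 'I_n & (G j i * K l i)%type}) =>
    u (tag x.1) j k l (tagged x.1).1 s (tagged x.1).2 t *
    (u (tag x.2) j k l (tagged x.2).1 s (tagged x.2).2 t)^*)
  (fun x => M x.1 *m z l *m (M x.2)^t*)).
apply: eq_bigr => k _; congr (_ *: _); apply: eq_bigr => s _.
rewrite mulmx_sumr mulmx_suml; apply: eq_bigr => t _.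
rewrite -(pair_bigA _ (fun x x' : {i : 'I_n & (G j i * K l i)%type} =>
  (u (tag x) j k l (tagged x).1 s (tagged x).2 t *
    (u (tag x') j k l (tagged x').1 s (tagged x').2 t)^*) *:
  (M x *m z l *m (M x')^t*))) /=.
have -> : (V k j s)^t* *m (V' k l t *m z l *m (V' k l t)^t*) *m V k j s =
   ((V k j s)^t* *m V' k l t) *m z l *m ((V k j s)^t* *m V' k l t)^t*.
  by rewrite adjmxM trmxCK !mulmxA.
rewrite overlap_expand !mulmx_suml; apply: eq_bigr => x _.
rewrite adjmx_sum mulmx_sumr; apply: eq_bigr => x' _.
by rewrite adjmxZ -!scalemxAl -scalemxAr scalerA.
Qed.

Let M_ortho j l (x x' : {i : 'I_n & (G j i * K l i)%type}) :
  (W j (tag x) (tagged x).1)^t* *m M x' *m W' l (tag x) (tagged x).2 =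
  (x == x')%:R%:M.
Proof.
rewrite /M; case: x x' => i [y z] [i' [y' z']] /=.
have [Wi Wo _] := frW j; have [W'i W'o _] := frW' l.
rewrite mulmxA -mulmxA -tag_eqE /tag_eq /=.
case: eqVneq => [ii'|ne]; last by rewrite Wo // mul0mx scalar_mx0.
subst i'; rewrite tagged_asE xpair_eqE Wi W'i mul_scalar_mx scale_scalar_mx.
by rewrite -natrM mulnb (eq_sym z').
Qed.

(** On [C], the conditional expectation onto [B] coincides with the one onto [A]
   exactly when [gram] is diagonal, with entries [beta j * gamma l / alpha i]:
   the latter expectation is given by the formula of [cexp_coord_gram] for this
   diagonal [gram], and the coefficients can be read off from the values on the
   elements [z] of the proof. *)
Lemma cexp_coord_gramP :
  (forall i, (0 < a i)%N) ->
  (forall z j, cexp_coord V delta (frame_emb V' z) j =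
     frame_emb W (cexp_coord W' gamma z) j) <->
  (forall j l (x x' : {i : 'I_n & (G j i * K l i)%type}),
     gram x x' = (x == x')%:R * (beta j * gamma l / alpha (tag x))).
Proof.
move=> a_gt0; split=> [eqE j l x x'|gramE z j]; last first.
  rewrite cexp_coord_gram frame_embE.
  under [RHS]eq_bigr => i _.
    under eq_bigr => y _.
      rewrite ffunE -scalemxAr -scalemxAl mulmx_sumr mulmx_suml scaler_sumr.
      over.
    rewrite exchange_big; over.
  rewrite exchange_big scaler_sumr; apply: eq_bigr => l _ /=.
  transitivity (\sum_(x : {i : 'I_n & (G j i * K l i)%type})
      (gamma l / alpha (tag x)) *: (M x *m z l *m (M x)^t*)).
    rewrite scaler_sumr; apply: eq_bigr => x _.
    rewrite (bigD1 x) //= gramE eqxx mul1r big1 ?addr0 => [|x' ne].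
      by rewrite scalerA !mulrA mulVf ?mul1r // gt_eqF.
    by rewrite gramE eq_sym (negPf ne) mul0r scale0r.
  rewrite (sum_tag_pair (fun i (y : G j i) (z' : K l i) =>
    (gamma l / alpha i) *: (W j i y *m (W' l i z')^t* *m z l *m
       (W j i y *m (W' l i z')^t*)^t*))).
  apply: eq_bigr => i _; apply: eq_bigr => y _.
  rewrite -scalemxAr -scalemxAl scalerA mulmx_sumr mulmx_suml scaler_sumr.
  apply: eq_bigr => z' _.
  by rewrite adjmxM trmxCK !mulmxA (mulrC (gamma l)).
pose e := Ordinal (a_gt0 (tag x)); pose e' := Ordinal (a_gt0 (tag x')).
pose S : 'M[F]_(a (tag x), a (tag x')) := delta_mx e e'.
(* The term of index [(x, x')] is the only one not killed by [W_x^* _ W_x']. *)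
pose z := mm_single
  (W' l (tag x) (tagged x).2 *m S *m (W' l (tag x') (tagged x').2)^t*).
have := congr1 (fun A => (W j (tag x) (tagged x).1)^t* *m A *m
  W j (tag x') (tagged x').1) (eqE z j).
rewrite /= -[in RHS]mulmxA frame_embMr //.
have -> : (W j (tag x) (tagged x).1)^t* *m
      (W j (tag x') (tagged x').1 *m cexp_coord W' gamma z (tag x')) =
    ((x == x')%:R * (gamma l / alpha (tag x'))) *: S.
  rewrite ffunE -!scalemxAr mulrC -scalerA mulrC -scalerA; congr (_ *: _).
  rewrite (bigD1 l) //= [X in _ + X]big1 ?addr0 => [|l' ne]; last first.
    rewrite big1 ?scaler0 // => t _.
    by rewrite mm_single_diff ?mulmx0 ?mul0mx // eq_sym.
  rewrite -!scalemxAr; congr (_ *: _).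
  rewrite mm_single_same -mul_scalar_mx -M_ortho /M.
  rewrite (bigD1 (tagged x').2) //= big1 ?addr0 => [|t ne].
    have [W'i _ _] := frW' l.
    by rewrite -!mulmxA W'i eqxx mulmx1.
  have [W'i _ _] := frW' l.
  by rewrite -!mulmxA W'i eq_sym (negPf ne) scalar_mx0 !mulmx0.
have sandwich y y' : (W j (tag x) (tagged x).1)^t* *m
      (M y *m z l *m (M y')^t*) *m W j (tag x') (tagged x').1 =
    (x == y)%:R%:M *m S *m (x' == y')%:R%:M.
  rewrite mm_single_same -M_ortho -[(x' == y')%:R]conjC_nat -adjmx_scalar.
  by rewrite -M_ortho !adjmxM !trmxCK !mulmxA.
rewrite cexp_coord_gram -scalemxAr -scalemxAl.
have -> : (W j (tag x) (tagged x).1)^t* *m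
    (\sum_l \sum_x0 \sum_(x1 : {i : 'I_n & (G j i * K l i)%type})
        gram x0 x1 *: (M x0 *m z l *m (M x1)^t*)) *m
      W j (tag x') (tagged x').1 = gram x x' *: S.
  rewrite mulmx_sumr mulmx_suml (bigD1 l) //= [X in _ + X]big1 => [|l' ne].
    rewrite addr0 mulmx_sumr mulmx_suml (bigD1 x) //= [X in _ + X]big1 => [|y ne].
      rewrite addr0 mulmx_sumr mulmx_suml (bigD1 x') //= big1 => [|y' ne].
        by rewrite addr0 -scalemxAr -scalemxAl sandwich !eqxx mul1mx mulmx1.
      rewrite -scalemxAr -scalemxAl sandwich (eq_sym x' y') (negPf ne).
      by rewrite scalar_mx0 mulmx0 scaler0.
    rewrite mulmx_sumr mulmx_suml big1 // => y' _.
    rewrite -scalemxAr -scalemxAl sandwich (eq_sym x y) (negPf ne).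
    by rewrite scalar_mx0 !mul0mx scaler0.
  rewrite mulmx_sumr mulmx_suml big1 // => y _.
  rewrite mulmx_sumr mulmx_suml big1 // => y' _.
  by rewrite mm_single_diff ?mulmx0 ?mul0mx 1?eq_sym // scaler0 mulmx0 mul0mx.
rewrite scalerA => /matrixP/(_ e e'); rewrite !mxE !eqxx !mulr1 => eqg.
rewrite -[LHS](mulVKf (x := beta j)) ?gt_eqF // eqg.
by case: eqP => [->|_]; rewrite ?mul0r ?mulr0 // !mul1r mulrA.
Qed.

End Core.

(** * Towers of embeddings *)

Section Tower.
Variables (F : numClosedFieldType) (q p n : nat).
Variables (d : 'I_q -> nat) (c : 'I_p -> nat) (a : 'I_n -> nat).
Variables (I : 'I_q -> 'I_p -> finType) (J : 'I_p -> 'I_n -> finType).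
Variable V : forall k l, I k l -> 'M[F]_(d k, c l).
Variable W : forall l i, J l i -> 'M[F]_(c l, a i).
Arguments V : clear implicits.
Arguments W : clear implicits.
Local Notation Z := (fun k => comp_frame (V k) W).
Local Notation Idx := (fun k i => {l : 'I_p & (J l i * I k l)%type} : finType).

Lemma frame_emb_comp y :
  frame_emb (I := Idx) Z y = frame_emb V (frame_emb W y).
Proof.
apply: mmP => k; rewrite !frame_embE.
under [LHS]eq_bigr => i _ do rewrite (sum_tag_pair (fun l z t =>
  V k l t *m W l i z *m y i *m (V k l t *m W l i z)^t*)).
rewrite exchange_big; apply: eq_bigr => l _ /=.
under [LHS]eq_bigr do rewrite exchange_big.
rewrite exchange_big; apply: eq_bigr => t _ /=.
rewrite frame_embE mulmx_sumr mulmx_suml; apply: eq_bigr => i _.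
rewrite mulmx_sumr mulmx_suml; apply: eq_bigr => z _.
by rewrite adjmxM !mulmxA.
Qed.

Variable delta : 'I_q -> F.

Lemma weight_comp i : weight Idx delta i = weight J (weight I delta) i.
Proof.
rewrite /weight; under [RHS]eq_bigr do rewrite mulr_suml.
rewrite exchange_big; apply: eq_bigr => k _ /=.
under eq_bigr do rewrite -mulrA; rewrite -mulr_sumr; congr (_ * _).
rewrite -sum1_card (sum_tag_pair (V := nat) (fun l (z : J l i) (t : I k l) => 1%N)).
rewrite natr_sum; apply: eq_bigr => l _.
by rewrite !sum_nat_const muln1 -natrM mulnC.
Qed.

Hypothesis frV : forall k, frame (V k).

(** On the intermediate algebra, the conditional expectation onto the smallest
   one is computed inside the intermediate algebra. *)
Lemma cexp_coord_comp z i :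
  cexp_coord (I := Idx) Z delta (frame_emb V z) i =
  cexp_coord W (weight I delta) z i.
Proof.
rewrite !ffunE weight_comp; congr (_ *: _).
under [LHS]eq_bigr => k _.
  rewrite (sum_tag_pair (fun l (y : J l i) (t : I k l) =>
    (V k l t *m W l i y)^t* *m frame_emb V z k *m (V k l t *m W l i y))).
  under eq_bigr => l _.
    under eq_bigr => y _.
      under eq_bigr => t _ do
        rewrite adjmxM -mulmxA (mulmxA (_ k)) frame_embMr // -2!mulmxA
          (mulmxA _ (V k l t)).
      rewrite /=.
      under eq_bigr => t _.
        have [-> _ _] := frV k; rewrite eqxx mul1mx.
        over.
      rewrite sumr_const -scaler_nat mulmxA.
      over.
    over.
  rewrite scaler_sumr.
  over.
rewrite exchange_big; apply: eq_bigr => l _ /=.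
rewrite scaler_suml; apply: eq_bigr => k _.
by rewrite -scaler_sumr scalerA.
Qed.

End Tower.

(** * Schur's lemma and transition matrices *)

Section Schur.
Variable F : numClosedFieldType.

Lemma commuting_scalar_mx n (o : 'I_n) (X : 'M[F]_n) :
  (forall S : 'M_n, S *m X = X *m S) -> X = (X o o)%:M.
Proof.
move=> cX; apply/matrixP => i j; have := congr1 (fun A : 'M_n => A o j) (cX (delta_mx o i)).
rewrite !mxE (bigD1 i) //= big1 ?addr0 => [|i' ne]; last first.
  by rewrite mxE (negPf ne) andbF mul0r.
rewrite [in RHS](bigD1 o) //= big1 ?addr0 => [|i' ne]; last first.
  by rewrite mxE (negPf ne) mulr0.
by rewrite !mxE !eqxx mul1r /= (eq_sym j) mulr_natr.
Qed.

(** Schur's lemma for the irreducible representations of a multi-matrix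
   algebra: self-intertwiners are scalars. *)
Lemma schur_same (n : nat) (a : 'I_n -> nat) i (o : 'I_(a i)) (X : 'M[F]_(a i)) :
  (forall x : multimatrix F a, x i *m X = X *m x i) -> X = (X o o)%:M.
Proof.
move=> cX; apply: commuting_scalar_mx => S.
by have := cX (mm_single S); rewrite mm_single_same.
Qed.

(** Schur's lemma: there are no intertwiners between inequivalent ones. *)
Lemma schur_diff (n : nat) (a : 'I_n -> nat) i i' (X : 'M[F]_(a i, a i')) :
  i != i' -> (forall x : multimatrix F a, x i *m X = X *m x i') -> X = 0.
Proof.
move=> ne /(_ (mm_single (1%:M : 'M_(a i)))).
by rewrite mm_single_same mm_single_diff // mul1mx mulmx0.
Qed.

(** Insert the resolution of the identity given by the second frame between two
   isometries of the first one. *)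
Lemma overlap_rows (N n : nat) (a : 'I_n -> nat) (X Y : 'I_n -> finType)
    (Z : forall i, X i -> 'M[F]_(N, a i)) (Z' : forall i, Y i -> 'M[F]_(N, a i))
    (u : forall i, X i -> Y i -> F) :
  (forall i, (0 < a i)%N) -> frame Z -> frame Z' ->
  (forall i x y, (Z i x)^t* *m Z' i y = (u i x y)%:M) ->
  (forall i i' x y, i != i' -> (Z i x)^t* *m Z' i' y = 0) ->
  forall i x x', \sum_y u i x y * (u i x' y)^* = (x == x')%:R.
Proof.
move=> a_gt0 [Zi _ _] [_ _ Z'1] uE u0 i x x'.
apply: (scalar_mx_inj (a_gt0 i)).
rewrite -Zi -[(Z i x)^t*]mulmx1 -Z'1 mulmx_sumr mulmx_suml (bigD1 i) //=.
rewrite [X in _ + X]big1 ?addr0 => [|i' ne]; last first.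
  by rewrite mulmx_sumr mulmx_suml big1 // => y _; rewrite mulmxA u0 ?mul0mx // eq_sym.
rewrite mulmx_sumr mulmx_suml raddf_sum; apply: eq_bigr => y _ /=.
rewrite mulmxA uE -mulmxA.
have -> : (Z' i y)^t* *m Z i x' = ((Z i x')^t* *m Z' i y)^t*.
  by rewrite adjmxM trmxCK.
by rewrite uE adjmx_scalar -scalar_mxM.
Qed.

(** The transition matrix between two decompositions into irreducibles is
   unitary. *)
Lemma overlap_unitary (N n : nat) (a : 'I_n -> nat) (X Y : 'I_n -> finType)
    (Z : forall i, X i -> 'M[F]_(N, a i)) (Z' : forall i, Y i -> 'M[F]_(N, a i))
    (u : forall i, X i -> Y i -> F) :
  (forall i, (0 < a i)%N) -> frame Z -> frame Z' ->
  (forall i x y, (Z i x)^t* *m Z' i y = (u i x y)%:M) ->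
  (forall i i' x y, i != i' -> (Z i x)^t* *m Z' i' y = 0) ->
  forall i, unitary (u i).
Proof.
move=> a_gt0 frZ frZ' uE u0 i; split=> [x x'|y y'].
  exact: (overlap_rows a_gt0 frZ frZ' uE u0).
rewrite -(@overlap_rows _ _ _ _ _ Z' Z (fun i y x => (u i x y)^*) a_gt0 frZ' frZ).
- by apply: eq_bigr => x _; rewrite conjCK.
- by move=> i' z x; rewrite -(trmxCK (Z i' x)) -adjmxM uE adjmx_scalar.
by move=> i1 i2 z x ne; rewrite -(trmxCK (Z i2 x)) -adjmxM u0 ?trmx0 ?map_mx0 // eq_sym.
Qed.

(** A square matrix with orthonormal rows is unitary. *)
Lemma unitary_of_rows (I J : finType) (v : I -> J -> F) :
  #|I| = #|J| ->
  (forall x x', \sum_y v x y * (v x' y)^* = (x == x')%:R) -> unitary v.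
Proof.
move=> eIJ vv; split=> // y y'.
pose f (h : 'I_#|I|) : J := enum_val (cast_ord eIJ h).
pose g (z : J) : 'I_#|I| := cast_ord (esym eIJ) (enum_rank z).
have fK : cancel f g by move=> h; rewrite /f /g enum_valK cast_ordK.
have gK : cancel g f by move=> z; rewrite /f /g cast_ordKV enum_rankK.
pose N : 'M[F]_#|I| := \matrix_(h, h') v (enum_val h) (f h').
have : N *m N^t* = 1%:M.
  apply/matrixP => h h'; rewrite !mxE -(inj_eq enum_val_inj) -vv.
  rewrite [RHS](reindex f) /=; last by exists g => z _; rewrite ?fK ?gK.
  by apply: eq_bigr => h1 _; rewrite !mxE.
move=> /mulmx1C/matrixP/(_ (g y) (g y')); rewrite !mxE (inj_eq (can_inj gK)) => <-.
rewrite (reindex (fun h : 'I_#|I| => enum_val h)) /=; last first.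
  by exists enum_rank => z _; rewrite ?enum_valK ?enum_rankK.
by apply: eq_bigr => h _; rewrite !mxE !gK.
Qed.

End Schur.

(** * Inclusion matrices and frames *)

Section Inclusion.
Variables (F : numClosedFieldType) (s : nat) (d : 'I_s -> nat) (r t : nat).
Variables (A : mmsub F d r) (B : mmsub F d t) (N : 'M[nat]_(r, t)).

(** The unitaries of an inclusion matrix are the same thing as frames, and the
   inclusion is then block diagonal. *)
Lemma frame_of_incl :
  ms_incl A N B ->
  exists2 W : forall j i, 'I_(N i j) -> 'M[F]_(ms_dim B j, ms_dim A i),
    forall j, @frame F _ _ _ (fun i => 'I_(N i j)) (W j) &
    forall x, ms_emb A x =
      ms_emb B (@frame_emb F _ _ _ _ (fun j i => 'I_(N i j)) W x).
Proof.
move=> [AB inc]; have U j := cid (inc j).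
pose W j i (rho : 'I_(N i j)) : 'M[F]_(ms_dim B j, ms_dim A i) :=
  \matrix_(h, e) sval (U j) h (existT _ i (rho, e)).
have frW j : @frame F _ _ _ (fun i => 'I_(N i j)) (W j).
  exact: (frame_of_unitary (I := fun i => 'I_(N i j)) (proj1 (svalP (U j)))).
exists W => // x.
have /ms_setP[y yx] : ms_set B (ms_emb A x) by apply: AB; exact: ms_set_emb.
rewrite -yx; congr ms_emb; apply: mmP => j.
apply: (@frame_emb_unique _ _ _ _ _ (fun j i => 'I_(N i j)) W frW) => i rho.
apply/matrixP => h e; rewrite !mxE.
have yW := proj2 (svalP (U j)) x y (esym yx) h i rho e.
etransitivity; [|etransitivity; [exact: yW|]]; apply: eq_bigr => h' _;
  by rewrite mxE.
Qed.

Lemma incl_of_frame (W : forall j i, 'I_(N i j) -> 'M[F]_(ms_dim B j, ms_dim A i)) :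
  (forall j, @frame F _ _ _ (fun i => 'I_(N i j)) (W j)) ->
  (forall x, ms_emb A x =
     ms_emb B (@frame_emb F _ _ _ _ (fun j i => 'I_(N i j)) W x)) ->
  ms_incl A N B.
Proof.
move=> frW AB; split=> [_ /ms_setP[x <-]|j]; first by rewrite AB; exact: ms_set_emb.
exists (fun h x => W j (tag x) (tagged x).1 h (tagged x).2); split.
  exact/(unitary_frame (I := fun i => 'I_(N i j))).
move=> x y; rewrite AB => /(se_inj (ms_embP B)) <- h i rho e.
have /matrixP/(_ h e) := @frame_embMr _ _ _ _ _ (fun j i => 'I_(N i j)) W frW x j i rho.
by rewrite !mxE.
Qed.

End Inclusion.

(** * Commuting squares *)

Section CommutingSquare.
Variables (F : numClosedFieldType) (n m p q : nat) (d : 'I_q -> nat).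
Variables (A : mmsub F d n) (B : mmsub F d m) (C : mmsub F d p).
Variables (G : 'I_m -> 'I_n -> finType) (H : 'I_q -> 'I_m -> finType).
Variables (K : 'I_p -> 'I_n -> finType) (L : 'I_q -> 'I_p -> finType).
Variable W : forall j i, G j i -> 'M[F]_(ms_dim B j, ms_dim A i).
Variable V : forall k j, H k j -> 'M[F]_(d k, ms_dim B j).
Variable W' : forall l i, K l i -> 'M[F]_(ms_dim C l, ms_dim A i).
Variable V' : forall k l, L k l -> 'M[F]_(d k, ms_dim C l).
Arguments W : clear implicits.
Arguments V : clear implicits.
Arguments W' : clear implicits.
Arguments V' : clear implicits.
Hypotheses (frW : forall j, frame (W j)) (frV : forall k, frame (V k)).
Hypotheses (frW' : forall l, frame (W' l)) (frV' : forall k, frame (V' k)).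
Hypothesis embB : ms_emb B =1 frame_emb V.
Hypothesis embC : ms_emb C =1 frame_emb V'.
Hypothesis embAB : forall x, ms_emb A x = ms_emb B (frame_emb W x).
Hypothesis embAC : forall x, ms_emb A x = ms_emb C (frame_emb W' x).

(** The copies of the irreducible representations of the small algebra seen
   through [B] and through [C] overlap in scalars, by Schur's lemma. *)
Lemma overlap_exists :
  exists u : forall i j k l, G j i -> H k j -> K l i -> L k l -> F,
    overlap W V W' V' u.
Proof.
pose o i := Ordinal (ms_dim_gt0 A i).
pose X i i' j k l (y : G j i) (s : H k j) (z : K l i') (t : L k l) :=
  (W j i y)^t* *m ((V k j s)^t* *m V' k l t) *m W' l i' z.
have cX i i' j k l (y : G j i) (s : H k j) (z : K l i') (t : L k l)
    (x : multimatrix F (ms_dim A)) :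
    x i *m X i i' j k l y s z t = X i i' j k l y s z t *m x i'.
  have -> : x i *m X i i' j k l y s z t =
     (V k j s *m (W j i y *m mm_star x i))^t* *m (V' k l t *m W' l i' z).
    by rewrite mm_starE !adjmxM trmxCK /X !mulmxA.
  rewrite -(frame_embMr frW) (mulmxA (V k j s)) -(frame_embMr frV) -embB -embAB.
  rewrite (se_star (ms_embP A)) mm_starE !adjmxM trmxCK -!mulmxA (mulmxA _ (V' k l t)).
  rewrite embAC embC (frame_embMr frV') -(mulmxA (V' k l t)) (frame_embMr frW').
  by rewrite /X !mulmxA.
exists (fun i j k l y s z t => X i i j k l y s z t (o i) (o i)); split.
  by move=> i j k l y s z t; rewrite -/(X i i j k l y s z t); exact: schur_same.
by move=> i i' j k l y s z t ne; apply: schur_diff ne _ => x; exact: cX.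
Qed.

Variable u : forall i j k l, G j i -> H k j -> K l i -> L k l -> F.
Hypothesis ovl : overlap W V W' V' u.
Variable delta : 'I_q -> F.
Local Notation beta := (weight H delta).
Local Notation gamma := (weight L delta).
Local Notation alpha := (weight K gamma).
Hypothesis delta_gt0 : forall k, 0 < delta k.
Hypothesis beta_gt0 : forall j, 0 < beta j.
Hypothesis gamma_gt0 : forall l, 0 < gamma l.
Hypothesis alpha_gt0 : forall i, 0 < alpha i.

(** The square commutes exactly when the expectations onto [A] and [B] agree on
   [C]: the identity for the other order of composition follows, because
   conditional expectations are self-adjoint for the trace. *)
Lemma commuting_squareP :
  commuting_square (wtrace delta) A B C <->
  (forall j l (x x' : {i : 'I_n & (G j i * K l i)%type}),
     gram u delta x x' = (x == x')%:R * (beta j * gamma l / alpha (tag x))).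
Proof.
rewrite -(cexp_coord_gramP frW frW' ovl) //; last exact: ms_dim_gt0.
pose Z' k := comp_frame (V' k) W'.
have frZ' k : frame (Z' k) by exact: frame_comp.
have embA x : ms_emb A x = frame_emb Z' x.
  by rewrite frame_emb_comp -embC embAC.
have trP := faithful_wtrace d delta_gt0.
have cA : cond_exp (wtrace delta) A (cexp Z' delta).
  apply: cond_exp_cexp => // i.
  by rewrite weight_comp.
have cB : cond_exp (wtrace delta) B (cexp V delta) by exact: cond_exp_cexp.
have cC : cond_exp (wtrace delta) C (cexp V' delta) by exact: cond_exp_cexp.
have AinB x : ms_set A x -> ms_set B x.
  by move=> /ms_setP[y <-]; rewrite embAB; exact: ms_set_emb.
have AinC x : ms_set A x -> ms_set C x.
  by move=> /ms_setP[y <-]; rewrite embAC; exact: ms_set_emb.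
have cAE z : cexp Z' delta (ms_emb C z) =
    ms_emb B (frame_emb W (cexp_coord W' gamma z)).
  rewrite -embAB embA; congr frame_emb; apply: mmP => i.
  by rewrite embC cexp_coord_comp.
have cBE z : cexp V delta (ms_emb C z) =
    ms_emb B (cexp_coord V delta (frame_emb V' z)).
  by rewrite embB -embC.
split=> [[EA [EB [EC [hA hB hC AE _]]]] z j|eqE].
  suff -> : cexp_coord V delta (frame_emb V' z) =
      frame_emb W (cexp_coord W' gamma z) by [].
  apply: (se_inj (ms_embP B)); rewrite -cBE -cAE.
  rewrite (cond_exp_unique trP cB hB) (cond_exp_unique trP cA hA) AE /=.
  by rewrite (ce_id hC) //; exact: ms_set_emb.
have eqC c : ms_set C c -> cexp V delta c = cexp Z' delta c.
  move=> /ms_setP[z <-]; rewrite cBE cAE; congr ms_emb.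
  by apply: mmP => j; rewrite eqE.
exists (cexp Z' delta), (cexp V delta), (cexp V' delta); split=> // x /=.
  rewrite eqC; last exact: (ce_range cC).
  apply: (tr_separates trP (ce_range cA _) (ce_range cA _)) => a Aa.
  by rewrite !(cond_exp_tr _ cA) // (cond_exp_tr _ cC) //; exact: AinC.
apply: (tr_separates trP (AinC _ (ce_range cA _)) (ce_range cC _)) => c Cc.
rewrite (cond_exp_tr _ cC) // (cond_exp_adj trP _ _ cA) (cond_exp_adj trP _ _ cB).
by rewrite eqC.
Qed.

End CommutingSquare.

Local Open Scope complex_scope.

(** * Trace weights and the matrices [v] *)

(* The index types of the copies of the [i]-th summand in the [j]-th one. *)
Local Notation copies N := (fun j i => 'I_(N i j) : finType).

Lemma card_tag_pair (m : nat) (J I : 'I_m -> finType) :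
  #|{: {j : 'I_m & (J j * I j)%type}}| = (\sum_j #|J j| * #|I j|)%N.
Proof.
rewrite -sum1_card (sum_tag_pair (V := nat) (fun j (y : J j) (t : I j) => 1%N)).
by apply: eq_bigr => j _; rewrite !sum_nat_const muln1.
Qed.

Lemma col_pos (n m : nat) (N : 'M[nat]_(n, m)) (j : 'I_m) :
  col j N != 0 -> exists i, (0 < N i j)%N.
Proof.
move=> N_nz; apply/existsP; apply: contraNT N_nz; rewrite negb_exists => /forallP N0.
by apply/eqP/colP => i; rewrite !mxE; apply/eqP; have := N0 i; rewrite -eqn0Ngt.
Qed.

Lemma row_pos (n m : nat) (N : 'M[nat]_(n, m)) (i : 'I_n) :
  row i N != 0 -> exists j, (0 < N i j)%N.
Proof.
move=> N_nz; apply/existsP; apply: contraNT N_nz; rewrite negb_exists => /forallP N0.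
by apply/eqP/rowP => j; rewrite !mxE; apply/eqP; have := N0 j; rewrite -eqn0Ngt.
Qed.

Section Weights.
Variable R : rcfType.

Lemma realmx_pos (n m : nat) (N : 'M[nat]_(n, m)) (x : 'cV[R]_m) :
  (forall i, row i N != 0) -> (forall j, 0 < x j 0) ->
  forall i, 0 < (Defs.realmx R N *m x) i 0.
Proof.
move=> N_nz x_gt0 i; have [j Nij] := row_pos (N_nz i).
rewrite mxE (bigD1 j) //= ltr_wpDr ?sumr_ge0 // => [j' _|].
  by rewrite mxE mulr_ge0 ?ler0n // ltW.
by rewrite mxE mulr_gt0 // ltr0n.
Qed.

Lemma realmxM (n1 n2 n3 : nat) (N : 'M[nat]_(n1, n2)) (N' : 'M[nat]_(n2, n3)) :
  Defs.realmx R (N *m N') = Defs.realmx R N *m Defs.realmx R N'.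
Proof.
apply/matrixP => i j; rewrite !mxE natr_sum; apply: eq_bigr => k _.
by rewrite !mxE natrM.
Qed.

Lemma weight_realmx (n m : nat) (N : 'M[nat]_(n, m)) (x : 'cV[R]_m) i :
  weight (copies N) (fun j => (x j 0)%:C) i = ((Defs.realmx R N *m x) i 0)%:C.
Proof.
rewrite mxE raddf_sum; apply: eq_bigr => j _ /=.
by rewrite card_ord mxE mulrC rmorphM /= rmorph_nat.
Qed.

Variables (n m p q : nat).
Variables (G : 'M[nat]_(n, m)) (H : 'M[nat]_(m, q)).
Variables (K : 'M[nat]_(n, p)) (L : 'M[nat]_(p, q)).
Variables (alpha : 'cV[R]_n) (beta : 'cV[R]_m).
Variables (gamma : 'cV[R]_p) (delta : 'cV[R]_q).
Hypotheses (alpha_gt0 : forall i, 0 < alpha i 0).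
Hypotheses (beta_gt0 : forall j, 0 < beta j 0).
Hypotheses (gamma_gt0 : forall l, 0 < gamma l 0).
Hypotheses (delta_gt0 : forall k, 0 < delta k 0).

Lemma sqrt_weights i i' j k l :
  Num.sqrt (alpha i 0 * delta k 0 / (beta j 0 * gamma l 0)) *
  Num.sqrt (alpha i' 0 * delta k 0 / (beta j 0 * gamma l 0)) =
  Num.sqrt (alpha i 0) * Num.sqrt (alpha i' 0) / (beta j 0 * gamma l 0) *
  delta k 0.
Proof.
have bg : 0 <= beta j 0 * gamma l 0 by rewrite mulr_ge0 // ltW.
have rE a : 0 < a -> Num.sqrt (a * delta k 0 / (beta j 0 * gamma l 0)) =
    Num.sqrt a * Num.sqrt (delta k 0) / Num.sqrt (beta j 0 * gamma l 0).
  move=> a_gt0; rewrite [LHS]sqrtrM; last by rewrite mulr_ge0 ?ltW.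
  by rewrite sqrtrV // [X in X / _]sqrtrM // ltW.
rewrite !rE // mulrACA -invfM -expr2 sqr_sqrtr // mulrACA -[_ (delta k 0) * _]expr2.
by rewrite sqr_sqrtr ?ltW // mulrAC.
Qed.

Variables (u : u_family R G H K L) (v : v_family R G H K L).

(** The entries of [u], with all indices separated. *)
Definition u_entry i j k l (rho : 'I_(G i j)) (sigma : 'I_(H j k))
    (phi : 'I_(K i l)) (psi : 'I_(L l k)) : R[i] :=
  u (existT _ j (rho, sigma)) (existT _ l (phi, psi)).

Hypothesis v_def : forall i j k l (rho : 'I_(G i j)) (sigma : 'I_(H j k))
  (phi : 'I_(K i l)) (psi : 'I_(L l k)),
  v (existT _ i (rho, phi)) (existT _ k (sigma, psi)) =
  (Num.sqrt (alpha i 0 * delta k 0 / (beta j 0 * gamma l 0)))%:C *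
  u_entry rho sigma phi psi.

(** The inner products of the rows of [v j l], from the definition of [v]. *)
Lemma rows_gram j l (x x' : {i : 'I_n & ('I_(G i j) * 'I_(K i l))%type}) :
  \sum_y v x y * Num.conj (v x' y) =
  (Num.sqrt (alpha (tag x) 0) * Num.sqrt (alpha (tag x') 0) /
     (beta j 0 * gamma l 0))%:C *
  gram (G := copies G) (H := copies H) (K := copies K) (L := copies L) u_entry
    (fun k => (delta k 0)%:C) x x'.
Proof.
case: x x' => [i [rho phi]] [i' [rho' phi']] /=.
rewrite (eq_bigr (fun y : {k : 'I_q & ('I_(H j k) * 'I_(L l k))%type} =>
  v (existT _ i (rho, phi)) (existT _ (tag y) ((tagged y).1, (tagged y).2)) *
  Num.conj (v (existT _ i' (rho', phi'))
    (existT _ (tag y) ((tagged y).1, (tagged y).2))))); last by move=> [k [s t]].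
rewrite (sum_tag_pair (fun k (s : 'I_(H j k)) (t : 'I_(L l k)) =>
  v (existT _ i (rho, phi)) (existT _ k (s, t)) *
  Num.conj (v (existT _ i' (rho', phi')) (existT _ k (s, t))))).
rewrite /gram mulr_sumr; apply: eq_bigr => k _.
rewrite mulrA mulr_sumr; apply: eq_bigr => s _; rewrite mulr_sumr.
apply: eq_bigr => t _ /=.
rewrite !v_def rmorphM /= (conj_Creal (x := _%:C)); last by rewrite complex_real.
by rewrite mulrACA -rmorphM sqrt_weights rmorphM.
Qed.

(** [gram] has the diagonal form of [cexp_coord_gramP] exactly when the rows of
   all the [v j l] are orthonormal. *)
Lemma rows_gramP :
  (forall j l (x x' : {i : 'I_n & ('I_(G i j) * 'I_(K i l))%type}),
    \sum_y v x y * Num.conj (v x' y) = (x == x')%:R) <->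
  (forall j l (x x' : {i : 'I_n & ('I_(G i j) * 'I_(K i l))%type}),
    gram (G := copies G) (H := copies H) (K := copies K) (L := copies L) u_entry
      (fun k => (delta k 0)%:C) x x' =
    (x == x')%:R * ((beta j 0)%:C * (gamma l 0)%:C / (alpha (tag x) 0)%:C)).
Proof.
have nz j l : beta j 0 * gamma l 0 != 0 by rewrite mulf_neq0 ?gt_eqF.
split=> gE j l x x'; last first.
  rewrite rows_gram gE; case: eqP => [->|_]; last by rewrite mul0r mulr0.
  rewrite mul1r -expr2 sqr_sqrtr ?ltW // -rmorphM -fmorphV -!rmorphM /=.
  by rewrite mulrA divfK // divff // gt_eqF.
have := gE j l x x'; rewrite rows_gram => {}gE.
have c_neq0 : (Num.sqrt (alpha (tag x) 0) * Num.sqrt (alpha (tag x') 0) /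
     (beta j 0 * gamma l 0))%:C != 0.
  by rewrite fmorph_eq0 gt_eqF // divr_gt0 ?mulr_gt0 ?sqrtr_gt0.
apply: (mulfI c_neq0); rewrite gE; case: eqP => [<-|_]; last by rewrite mul0r mulr0.
rewrite mul1r -expr2 sqr_sqrtr ?ltW // -rmorphM -fmorphV -!rmorphM /=.
by rewrite mulrA divfK // divff // gt_eqF.
Qed.

End Weights.


(** * From a commuting square to a bi-unitary *)

Section Necessity.
Variables (R : realType) (n m p q : nat).
Variables (G : 'M[nat]_(n, m)) (H : 'M[nat]_(m, q)).
Variables (K : 'M[nat]_(n, p)) (L : 'M[nat]_(p, q)).
Hypotheses (G_nz : no_zero_lines G) (H_nz : no_zero_lines H).
Hypothesis L_nz : no_zero_lines L.
Hypotheses (GH_KL : G *m H = K *m L) (GtK_HLt : G^T *m K = H *m L^T).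

Lemma trace_weights_of (delta : 'cV[R]_q) :
  (forall k, 0 < delta k 0) ->
  let beta := Defs.realmx R H *m delta in
  let gamma := Defs.realmx R L *m delta in
  trace_weights G H K L (Defs.realmx R G *m beta) beta gamma delta.
Proof.
move=> delta_gt0; split=> //.
by rewrite !mulmxA -!realmxM GH_KL.
Qed.

(** The matrices [v j l] are square, because [G^T K = H L^T]. *)
Lemma card_rows j l :
  #|{: {i : 'I_n & ('I_(G i j) * 'I_(K i l))%type}}| =
  #|{: {k : 'I_q & ('I_(H j k) * 'I_(L l k))%type}}|.
Proof.
rewrite (card_tag_pair (fun i => 'I_(G i j)) (fun i => 'I_(K i l))).
rewrite (card_tag_pair (fun k => 'I_(H j k)) (fun k => 'I_(L l k))).
have := congr1 (fun N : 'M[nat]_(m, p) => N j l) GtK_HLt; rewrite !mxE => e.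
transitivity (\sum_i G^T j i * K i l)%R; first last.
  by rewrite e; apply: eq_bigr => k _; rewrite !card_ord mxE.
by apply: eq_bigr => i _; rewrite !card_ord mxE.
Qed.

Lemma bi_unitary_of_commuting_square (d : 'I_q -> nat)
    (d_gt0 : forall k, (0 < d k)%N) (tr : multimatrix R[i] d -> R[i])
    (A : mmsub R[i] d n) (B : mmsub R[i] d m) (C : mmsub R[i] d p) :
  let D : mmsub R[i] d q := ms_full R[i] d_gt0 in
  faithful_trace tr ->
  ms_incl A G B -> ms_incl B H D -> ms_incl A K C -> ms_incl C L D ->
  commuting_square tr A B C ->
  exists (alpha : 'cV[R]_n) (beta : 'cV[R]_m)
         (gamma : 'cV[R]_p) (delta : 'cV[R]_q)
         (u : u_family R G H K L) (v : v_family R G H K L),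
    trace_weights G H K L alpha beta gamma delta /\
    bi_unitary alpha beta gamma delta u v.
Proof.
move=> D trP AB BD AC CD sq.
have [deltaC deltaC_gt0 trE] := faithful_traceE d_gt0 trP.
have {trP trE}tr_eq : tr = wtrace deltaC by apply/funext.
pose delta : 'cV[R]_q := \col_k complex.Re (deltaC k).
have delta_eq : deltaC = fun k => (delta k 0)%:C.
  by apply/funext => k; rewrite mxE RRe_real // gtr0_real.
have delta_gt0 k : 0 < delta k 0.
  by rewrite -ltcR -[(delta k 0)%:C]/((fun k => (delta k 0)%:C) k) -delta_eq.
move: tr_eq; rewrite delta_eq => tr_eq; rewrite tr_eq in sq.
pose beta := Defs.realmx R H *m delta; pose gamma := Defs.realmx R L *m delta.
pose alpha := Defs.realmx R G *m beta.
have tw : trace_weights G H K L alpha beta gamma delta.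
  exact: trace_weights_of.
have beta_gt0 j : 0 < beta j 0 by apply: realmx_pos => //; case: H_nz.
have gamma_gt0 l : 0 < gamma l 0 by apply: realmx_pos => //; case: L_nz.
have alpha_gt0 i : 0 < alpha i 0 by apply: realmx_pos => //; case: G_nz.
have [W frW embAB] := frame_of_incl AB.
have [V frV embB] := frame_of_incl BD.
have [W' frW' embAC] := frame_of_incl AC.
have [V' frV' embC] := frame_of_incl CD.
have [u ovl] := overlap_exists (G := copies G) (H := copies H) (K := copies K)
  (L := copies L) frW frV frW' frV' embB embC embAB embAC.
have wH j : weight (copies H) (fun k => (delta k 0)%:C) j = (beta j 0)%:C.
  exact: weight_realmx.
have wL : weight (copies L) (fun k => (delta k 0)%:C) = fun l => (gamma l 0)%:C.
  by apply/funext => l; exact: weight_realmx.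
have wK i : weight (copies K) (fun l => (gamma l 0)%:C) i = (alpha i 0)%:C.
  by rewrite weight_realmx; case: tw => _ _ _ _ <-.
pose uf : u_family R G H K L := fun i k x y =>
  u i (tag x) k (tag y) (tagged x).1 (tagged x).2 (tagged y).1 (tagged y).2.
pose vf : v_family R G H K L := fun j l x y =>
  (Num.sqrt (alpha (tag x) 0 * delta (tag y) 0 / (beta j 0 * gamma l 0)))%:C *
  u (tag x) j (tag y) l (tagged x).1 (tagged y).1 (tagged x).2 (tagged y).2.
exists alpha, beta, gamma, delta, uf, vf; split=> //; split.
- move=> i k.
  apply: (@overlap_unitary _ _ _ _
    (fun i => {j : 'I_m & ('I_(G i j) * 'I_(H j k))%type})
    (fun i => {l : 'I_p & ('I_(K i l) * 'I_(L l k))%type})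
    (comp_frame (I := copies H k) (J := copies G) (V k) W)
    (comp_frame (I := copies L k) (J := copies K) (V' k) W') (fun i => uf i k)).
  + exact: ms_dim_gt0.
  + exact: (frame_comp (I := copies H k) (J := copies G)).
  + exact: (frame_comp (I := copies L k) (J := copies K)).
  + case: ovl => ov _ i' [j [y s]] [l [z t]]; rewrite /comp_frame /=.
    by rewrite adjmxM -ov !mulmxA.
  case: ovl => _ ov i1 i2 [j [y s]] [l [z t]] ne; rewrite /comp_frame /=.
  by rewrite adjmxM -(ov i1 i2 j k l y s z t ne) !mulmxA.
- move=> j l; apply: unitary_of_rows; first exact: card_rows.
  move: j l; apply/(rows_gramP alpha_gt0 beta_gt0 gamma_gt0 delta_gt0
    (u := uf) (v := vf)) => //.
  move: sq; rewrite (commuting_squareP (G := copies G) (H := copies H) (K := copies K)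
    (L := copies L) frW frV frW' frV' embB embC embAB embAC ovl) => //.
  + by move=> gE j l x x'; have := gE j l x x'; rewrite wH wL wK.
  + by move=> k; rewrite ltcR.
  + by move=> j; rewrite wH ltcR.
  + by move=> l; rewrite wL ltcR.
  by move=> i; rewrite wL wK ltcR.
by [].
Qed.

End Necessity.


Lemma star_embedding_comp (F : numClosedFieldType) (r s t : nat) (a : 'I_r -> nat)
    (b : 'I_s -> nat) (c : 'I_t -> nat)
    (f : multimatrix F b -> multimatrix F c) (g : multimatrix F a -> multimatrix F b) :
  star_embedding f -> star_embedding g -> star_embedding (f \o g).
Proof.
move=> [f1 f2 f3 f4 f5] [g1 g2 g3 g4 g5]; split.
- by move=> x y z /=; rewrite g1 f1.
- by move=> x y /=; rewrite g2 f2.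
- by rewrite /= g3 f3.
- by move=> x /=; rewrite g4 f4.
exact: inj_comp.
Qed.

(** * From a bi-unitary to a commuting square *)

Section Sufficiency.
Variables (R : realType) (n m p q : nat).
Variables (G : 'M[nat]_(n, m)) (H : 'M[nat]_(m, q)).
Variables (K : 'M[nat]_(n, p)) (L : 'M[nat]_(p, q)).
Hypotheses (G_nz : no_zero_lines G) (H_nz : no_zero_lines H).
Hypotheses (K_nz : no_zero_lines K) (L_nz : no_zero_lines L).

(** The block sizes: [A] is commutative, and the others are determined by the
   inclusion matrices. *)
Definition a_dim (i : 'I_n) : nat := 1.
Definition b_dim (j : 'I_m) : nat :=
  #|{: {i : 'I_n & ('I_(G i j) * 'I_(a_dim i))%type}}|.
Definition c_dim (l : 'I_p) : nat :=
  #|{: {i : 'I_n & ('I_(K i l) * 'I_(a_dim i))%type}}|.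
Definition d_dim (k : 'I_q) : nat :=
  #|{: {j : 'I_m & ('I_(H j k) * 'I_(b_dim j))%type}}|.

Lemma a_dim_gt0 i : (0 < a_dim i)%N. Proof. by []. Qed.

Lemma b_dim_gt0 j : (0 < b_dim j)%N.
Proof.
have [_ /(_ j)/col_pos[i Gij]] := G_nz.
by apply/card_gt0P; exists (existT _ i (Ordinal Gij, ord0)).
Qed.

Lemma c_dim_gt0 l : (0 < c_dim l)%N.
Proof.
have [_ /(_ l)/col_pos[i Kil]] := K_nz.
by apply/card_gt0P; exists (existT _ i (Ordinal Kil, ord0)).
Qed.

Lemma d_dim_gt0 k : (0 < d_dim k)%N.
Proof.
have [_ /(_ k)/col_pos[j Hjk]] := H_nz.
by apply/card_gt0P; exists (existT _ j (Ordinal Hjk, Ordinal (b_dim_gt0 j))).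
Qed.

Variable u : u_family R G H K L.
Arguments u : clear implicits.
Hypothesis u_unitary : forall i k, unitary (u i k).

Local Notation F := (complex R).

(** The canonical frames of the inclusions of [A] in [B], of [A] in [C] and of
   [B] in [D]. *)
Definition WAB j i (rho : 'I_(G i j)) : 'M[F]_(b_dim j, a_dim i) :=
  std_frame F a_dim (I := copies G j) rho.
Definition WAC l i (phi : 'I_(K i l)) : 'M[F]_(c_dim l, a_dim i) :=
  std_frame F a_dim (I := copies K l) phi.
Definition VBD k j (sigma : 'I_(H j k)) : 'M[F]_(d_dim k, b_dim j) :=
  std_frame F b_dim (I := copies H k) sigma.

(** The decomposition of the representations of [D] over [A] through [B], and
   (in [ZCD]) the one obtained from it by the unitaries [u i k], to be regrouped
   into copies of the representations of [C]. *)
Definition ZBD k i (x : {j : 'I_m & ('I_(G i j) * 'I_(H j k))%type}) :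
    'M[F]_(d_dim k, a_dim i) :=
  comp_frame (I := copies H k) (J := copies G) (@VBD k) WAB x.
Definition ZCD k i (y : {l : 'I_p & ('I_(K i l) * 'I_(L l k))%type}) :
    'M[F]_(d_dim k, a_dim i) :=
  rot_frame (X := fun i => {j : 'I_m & ('I_(G i j) * 'I_(H j k))%type})
    (Y := fun i => {l : 'I_p & ('I_(K i l) * 'I_(L l k))%type})
    (fun i => u i k) (@ZBD k) y.
(** The frame of the inclusion of [C] in [D]. *)
Definition VCD k l (psi : 'I_(L l k)) : 'M[F]_(d_dim k, c_dim l) :=
  group_frame (I := copies L k) (J := copies K) (@ZCD k) WAC psi.

Lemma frame_WAB j : frame (I := copies G j) (@WAB j). Proof. exact: frame_std. Qed.
Lemma frame_WAC l : frame (I := copies K l) (@WAC l). Proof. exact: frame_std. Qed.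
Lemma frame_VBD k : frame (I := copies H k) (@VBD k). Proof. exact: frame_std. Qed.

Lemma frame_ZBD k :
  frame (I := fun i => {j : 'I_m & ('I_(G i j) * 'I_(H j k))%type}) (@ZBD k).
Proof.
exact: (frame_comp (I := copies H k) (J := copies G) (@frame_VBD k) frame_WAB).
Qed.

Lemma frame_ZCD k :
  frame (I := fun i => {l : 'I_p & ('I_(K i l) * 'I_(L l k))%type}) (@ZCD k).
Proof. by apply: frame_rot => // [|i]; [exact: frame_ZBD | exact: u_unitary]. Qed.

Lemma frame_VCD k : frame (I := copies L k) (@VCD k).
Proof.
exact: (frame_group (I := copies L k) (J := copies K) (@frame_ZCD k) frame_WAC).
Qed.

Definition embAB := frame_emb (I := copies G) WAB.
Definition embAC := frame_emb (I := copies K) WAC.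
Definition embBD := frame_emb (I := copies H) VBD.
Definition embCD := frame_emb (I := copies L) VCD.

(** Both routes from [A] to [D] agree: a change of the decomposition inside the
   isotypical components does not affect the embedding. *)
Lemma embAD x : embBD (embAB x) = embCD (embAC x).
Proof.
rewrite /embBD /embAB /embCD /embAC.
rewrite -(frame_emb_comp (I := copies H) (J := copies G)).
rewrite -(frame_emb_comp (I := copies L) (J := copies K)).
apply: mmP => k; rewrite !frame_embE; apply: eq_bigr => i _.
transitivity (\sum_y ZCD y *m x i *m (ZCD (k := k) y)^t*).
  symmetry; exact: (rot_frame_sandwich
    (X := fun i => {j : 'I_m & ('I_(G i j) * 'I_(H j k))%type})
    (Y := fun i => {l : 'I_p & ('I_(K i l) * 'I_(L l k))%type})
    (u := fun i => u i k) (@ZBD k) (x i) (u_unitary i k)).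
apply: eq_bigr => y _.
have e : comp_frame (I := copies L k) (J := copies K) (@VCD k) WAC y = ZCD y.
  exact: (comp_group_frame (I := copies L k) (J := copies K) (@ZCD k) frame_WAC y).
by rewrite -e.
Qed.

Lemma star_embBD : star_embedding embBD.
Proof.
apply: (star_embedding_frame (I := copies H)); first exact: frame_VBD.
move=> j; have [/(_ j)/row_pos[k Hjk] _] := H_nz.
by exists k; rewrite card_ord.
Qed.

Lemma star_embCD : star_embedding embCD.
Proof.
apply: (star_embedding_frame (I := copies L)); first exact: frame_VCD.
move=> l; have [/(_ l)/row_pos[k Llk] _] := L_nz.
by exists k; rewrite card_ord.
Qed.

Lemma star_embAB : star_embedding embAB.
Proof.
apply: (star_embedding_frame (I := copies G)); first exact: frame_WAB.
move=> i; have [/(_ i)/row_pos[j Gij] _] := G_nz.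
by exists j; rewrite card_ord.
Qed.

(** The algebras of the square, as subalgebras of [D]. *)
Definition algA : mmsub F d_dim n :=
  MMSub a_dim_gt0 (star_embedding_comp star_embBD star_embAB).
Definition algB : mmsub F d_dim m := MMSub b_dim_gt0 star_embBD.
Definition algC : mmsub F d_dim p := MMSub c_dim_gt0 star_embCD.

(** By construction, the transition matrices of the square are the given [u]. *)
Lemma overlap_constr :
  overlap (G := copies G) (H := copies H) (K := copies K) (L := copies L)
    WAB VBD WAC VCD (u_entry u).
Proof.
have ZE k i l (phi : 'I_(K i l)) (psi : 'I_(L l k)) :
    VCD psi *m WAC phi = ZCD (existT _ l (phi, psi)).
  exact: (comp_group_frame (I := copies L k) (J := copies K) (@ZCD k)
    frame_WAC (existT _ l (phi, psi))).
split=> [i j k l rho sigma phi psi | i i' j k l rho sigma phi psi ne].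
  rewrite -!mulmxA ZE mulmxA -adjmxM.
  exact: (frame_rot_overlap (fun i => u i k) (existT _ j (rho, sigma))
    (existT _ l (phi, psi)) (@frame_ZBD k)).
rewrite -!mulmxA ZE mulmxA -adjmxM.
exact: (frame_rot_ortho (fun i => u i k) (existT _ j (rho, sigma))
    (existT _ l (phi, psi)) (@frame_ZBD k) ne).
Qed.

Lemma commuting_square_of_bi_unitary (alpha : 'cV[R]_n) (beta : 'cV[R]_m)
    (gamma : 'cV[R]_p) (delta : 'cV[R]_q) (v : v_family R G H K L) :
  trace_weights G H K L alpha beta gamma delta ->
  bi_unitary alpha beta gamma delta u v ->
  let D : mmsub F d_dim q := ms_full F d_dim_gt0 in
  exists tr : multimatrix F d_dim -> F,
    [/\ faithful_trace tr, ms_incl algA G algB /\ ms_incl algB H D,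
        ms_incl algA K algC /\ ms_incl algC L D
      & commuting_square tr algA algB algC].
Proof.
case=> delta_gt0 betaE gammaE alphaE alphaE' [_ v_unitary v_def] D.
have beta_gt0 j : 0 < beta j 0 by rewrite betaE; apply: realmx_pos => //; case: H_nz.
have gamma_gt0 l : 0 < gamma l 0 by rewrite gammaE; apply: realmx_pos => //; case: L_nz.
have alpha_gt0 i : 0 < alpha i 0 by rewrite alphaE; apply: realmx_pos => //; case: G_nz.
have wH j : weight (copies H) (fun k => (delta k 0)%:C) j = (beta j 0)%:C.
  by rewrite weight_realmx betaE.
have wL : weight (copies L) (fun k => (delta k 0)%:C) = fun l => (gamma l 0)%:C.
  by apply/funext => l; rewrite weight_realmx gammaE.
have wK i : weight (copies K) (fun l => (gamma l 0)%:C) i = (alpha i 0)%:C.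
  by rewrite weight_realmx alphaE'.
have deltaC_gt0 k : 0 < (delta k 0)%:C by rewrite ltcR.
exists (wtrace (fun k => (delta k 0)%:C)); split.
- exact: faithful_wtrace.
- split; first exact: (incl_of_frame (A := algA) (B := algB) frame_WAB).
  exact: (incl_of_frame (A := algB) (B := D) frame_VBD).
- split; last exact: (incl_of_frame (A := algC) (B := D) frame_VCD).
  apply: (incl_of_frame (A := algA) (B := algC) frame_WAC) => x; exact: embAD.
apply/(commuting_squareP (A := algA) (B := algB) (C := algC) (G := copies G)
  (H := copies H) (K := copies K) (L := copies L) frame_WAB frame_VBD frame_WAC
  frame_VCD _ _ _ embAD overlap_constr) => //.
- by move=> j; rewrite wH ltcR.
- by move=> l; rewrite wL ltcR.
- by move=> i; rewrite wL wK ltcR.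
move=> j l x x'; rewrite wH wL wK; move: j l x x'.
apply/(rows_gramP alpha_gt0 beta_gt0 gamma_gt0 delta_gt0 (v := v)) => //.
by move=> j l; case: (v_unitary j l).
Qed.

End Sufficiency.

Theorem theorem1p10 (R : realType) (n m p q : nat)
    (G : 'M[nat]_(n, m)) (H : 'M[nat]_(m, q))
    (K : 'M[nat]_(n, p)) (L : 'M[nat]_(p, q))
    (G_nz : no_zero_lines G) (H_nz : no_zero_lines H)
    (K_nz : no_zero_lines K) (L_nz : no_zero_lines L)
    (GH_KL : G *m H = K *m L) (GtK_HLt : G^T *m K = H *m L^T) :
  (exists (d : 'I_q -> nat) (d_gt0 : forall k, (0 < d k)%N)
          (tr : multimatrix R[i] d -> R[i])
          (A : mmsub R[i] d n) (B : mmsub R[i] d m) (C : mmsub R[i] d p),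
     let D : mmsub R[i] d q := ms_full R[i] d_gt0 in
     [/\ faithful_trace tr,
         ms_incl A G B /\ ms_incl B H D,
         ms_incl A K C /\ ms_incl C L D,
         symmetric_inclusions G H K L
       & commuting_square tr A B C])
  <->
  (exists (alpha : 'cV[R]_n) (beta : 'cV[R]_m)
          (gamma : 'cV[R]_p) (delta : 'cV[R]_q)
          (u : u_family R G H K L) (v : v_family R G H K L),
     trace_weights G H K L alpha beta gamma delta /\
     bi_unitary alpha beta gamma delta u v).
Proof.
split.
  case=> d [d_gt0 [tr [A [B [C /= [trP [AB BD] [AC CD] _ sq]]]]]].
  exact: (bi_unitary_of_commuting_square G_nz H_nz L_nz GH_KL GtK_HLt trP AB BD AC CD sq).
case=> alpha [beta [gamma [delta [u [v [tw bu]]]]]].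
have u_unitary i k : unitary (u i k) by case: bu.
have [tr [trP AB AC sq]] :=
  commuting_square_of_bi_unitary G_nz H_nz K_nz L_nz u_unitary tw bu.
by exists (d_dim G H), (d_dim_gt0 G_nz H_nz), tr, (algA R G_nz H_nz),
  (algB R G_nz H_nz), (algC K_nz L_nz u_unitary); split.
Qed.
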